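(* For any integers $d\ge 1$, $c_1,\ldots,c_d\in\{1,3\}$ with $c_1\ge 3$, and any complex numbers $z_0,z_1,\ldots,z_d$ with $|z_j|<1$, $j=0,1,\ldots,d$, we have $$\sum_{a_0,a_1,\ldots,a_d\ge 0}\zeta^{\star}(\{2\}^{a_0},c_1,\{2\}^{a_1},\ldots,c_d,\{2\}^{a_d})\,z_0^{2a_0}z_1^{2a_1}\cdots z_d^{2a_d}=-\sum_{k_0\ge k_1\ge\cdots\ge k_d\ge 1}\prod_{i=0}^d\frac{(-1)^{k_i\delta_i}k_i^{\delta_i-1}}{k_i^2-z_i^2}\,2^{\Delta(k_{i-1},k_i)},$$ where $c_0=1$, $c_{d+1}=0$, $k_{-1}=0$, $\delta_i=\delta(c_i)+\delta(c_{i+1})$ for $0\le i\le d$, and $\delta(c)=2$ if $c=0$, $\delta(c)=1$ if $c=1$, $\delta(c)=0$ if $c\ge 3$.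
   Context: For positive integers $s_1,\ldots,s_m$ with $s_1\ge 2$, $\zeta^\star(s_1,\ldots,s_m)=\sum_{k_1\ge\cdots\ge k_m\ge 1}\frac{1}{k_1^{s_1}\cdots k_m^{s_m}}$ (sum over positive integers), and $\zeta^\star(\emptyset)=1$. $\{2\}^a$ denotes the sequence consisting of $a$ copies of $2$ (empty if $a=0$). $\Delta(a,b)=0$ if $a=b$ and $\Delta(a,b)=1$ otherwise. In all sums the indices are integers, and $0^0=1$ in power series. *)

(* Defs.v *)
From HB Require Import structures.
From mathcomp Require Import all_boot all_order all_algebra finmap.
From mathcomp Require Import complex.
From mathcomp Require Import all_classical all_reals all_analysis.
From mathcomp.analysis.showcase Require Import summability.

Set Implicit Arguments.
Unset Strict Implicit.
Unset Printing Implicit Defensive.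

Import Order.TTheory GRing.Theory Num.Theory numFieldNormedType.Exports.

Local Open Scope classical_set_scope.
Local Open Scope ring_scope.
Local Open Scope complex_scope.

(* Weakly decreasing m-tuples k_1 >= ... >= k_m >= 1. *)
Definition chain (m : nat) : choiceType :=
  {k : m.-tuple nat | sorted geq k && all (leq 1) k}.

(* The terms are nonnegative, so the series is their extended-real sum; [fine]
   sends it to 0 when it diverges, which never happens if s starts with an
   entry >= 2 and has only positive entries.  For s = [::] the only chain is
   the empty one, with term the empty product 1. *)
Definition zeta_star (R : realType) (s : seq nat) : R :=
  fine (\esum_(k in [set: chain (size s)])
          (\prod_(i < size s) (tnth (val k) i)%:R ^- nth 0%N s i)%:E).

(* The sequence {2}^{a_0}, c_1, {2}^{a_1}, ..., c_d, {2}^{a_d}. *)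
Definition insert_twos (c a : seq nat) : seq nat :=
  nseq (head 0%N a) 2%N ++
  flatten [seq p.1 :: nseq p.2 2%N | p <- zip c (behead a)].

Definition Delta (a b : nat) : nat := if a == b then 0%N else 1%N.

(* delta 2 is irrelevant: delta is only applied to 0, 1 and integers >= 3. *)
Definition delta (c : nat) : nat :=
  if c == 0%N then 2%N else if c == 1%N then 1%N else 0%N.

(* delta_i = delta(c_i) + delta(c_{i+1}), 0 <= i <= d, where the sequence c
   lists c_1, ..., c_d and is extended by c_0 = 1 and c_{d+1} = 0. *)
Definition delta_sum (c : seq nat) (i : nat) : nat :=
  let c' := 1%N :: rcons c 0%N in
  (delta (nth 0 c' i) + delta (nth 0 c' i.+1))%N.

(* The codomain R[i]^o is R[i] seen as a normed space over itself, which is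
   where the library's sums of families live. *)
Definition zeta_star_term (R : realType) (d : nat) (c : seq nat)
    (z : 'I_d.+1 -> R[i]) (a : d.+1.-tuple nat) : R[i]^o :=
  ((zeta_star R (insert_twos c a))%:C
     * \prod_(j < d.+1) z j ^+ (2 * tnth a j) : R[i]).

(* [nth 0 (0 :: k) i] is k_{i-1}, with k_{-1} = 0. *)
Definition chain_term (R : realType) (d : nat) (c : seq nat)
    (z : 'I_d.+1 -> R[i]) (ch : chain d.+1) : R[i]^o :=
  let k := val ch in
  (\prod_(i < d.+1)
     ((-1) ^+ (tnth k i * delta_sum c i)
       * (tnth k i)%:R ^ ((delta_sum c i)%:Z - 1)
       / ((tnth k i)%:R ^+ 2 - z i ^+ 2)
       * 2 ^+ Delta (nth 0%N (0%N :: k) i) (tnth k i)) : R[i]).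

(* Main.v *)
Require Import Defs.
From mathcomp Require Import all_boot all_order all_algebra finmap.
From mathcomp Require Import complex.
From mathcomp Require Import all_classical all_reals all_analysis.
From mathcomp.analysis.showcase Require Import summability.
From mathcomp Require Import ring lra zify.

Set Implicit Arguments.
Unset Strict Implicit.
Unset Printing Implicit Defensive.

Import Order.TTheory GRing.Theory Num.Theory numFieldNormedType.Exports.

Local Open Scope classical_set_scope.
Local Open Scope ring_scope.
Local Open Scope complex_scope.

(** Let g_n(c; z) be the left-hand generating function in which all summation
    indices of the zeta-star values are at most n.  The terms whose outermost
    index is n come from the first 2 (when a_0 > 0) or from c_1 (when a_0 = 0),
    so that
      (1 - z_0^2/n^2) g_n(c; z) = g_(n-1)(c; z) + n^(-c_1) g_n(c'; z'),
    where c' and z' drop c_1 and z_0 ([gen_trunc]).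

    The truncated right-hand side carries the weight
    B(n, k) = n!^2 / ((n-k)! (n+k)!): if y_k is the sum of the chain products
    with k_0 = k, then g_n = - sum_(k <= n) B(n, k) y_k ([gen_truncE]).  This
    follows by induction on the length of c and on n.  As
    (n^2 - k^2) B(n, k) = n^2 B(n-1, k), the recursion for g_n turns into the
    claim that the sum of B(n, k) (k^2 - z_0^2) y_k over k <= n is
    n^(2 - c_1) times the sum of B(n, k) y'_k, for y' built from c' and z'.
    For c_1 = 1 and c_1 = 3 this multiplies or divides by n a sum against
    B(n, k); both operations are done by summation by parts
    ([sum_cbin_even], [sum_cbin_alt]), because
    (n+k+1) B(n, k+1) = (n-k) B(n, k), and the factors 2^Delta record the two
    consecutive partial sums which appear in this way ([sum_Delta]).

    Now let n tend to infinity.  The right-hand side converges absolutely,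
    since the nested sums behind k_0 grow at most like a harmonic number H_k
    (this uses c_1 = 3) and the sum of H_k / k^2 is finite
    ([nest_bound_bounded]).  As 0 <= 1 - B(n, k) <= k^2/n, the weights may be
    replaced by 1 in the limit ([chain_sum_cvg]).  On the left, the terms of
    total degree at least N in a_0, ..., a_d are at most th^N times the same
    generating function at slightly larger radii, uniformly in n, because they
    obey the same recursion ([gen_deg_error]).  The closed form bounds the
    latter uniformly in n, so the limits in n and in N can be exchanged
    ([zeta_sum_cvg]).  Both families are dominated by summable ones, so that
    their sums along arbitrary finite subsets converge to these limits
    ([partial_sum_cvg]). *)

(** * Nested sums over weakly decreasing chains *)

(** With weights w_0, ..., w_m this is the sum over n >= k_0 >= ... >= k_m >=
    1 of the product of the w_i k_(i-1) k_i, where k_(-1) = p; the same shape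
    serves the right-hand side of the theorem, its absolute majorant and the
    truncated zeta-star values. *)
Fixpoint nest (F : pzSemiRingType) (ws : seq (nat -> nat -> F)) (p n : nat) : F :=
  if ws is w :: ws' then \sum_(1 <= k < n.+1) w p k * nest ws' k k else 1.

Fixpoint chain_prod (F : pzSemiRingType) (ws : seq (nat -> nat -> F)) (p : nat)
    (ks : seq nat) : F :=
  match ws, ks with
  | w :: ws', k :: ks' => w p k * chain_prod ws' k ks'
  | _, _ => 1
  end.

Fixpoint chains (m n : nat) : seq (seq nat) :=
  if m is m'.+1 then [seq k :: s | k <- index_iota 1 n.+1, s <- chains m' k]
  else [:: [::]].

Lemma mem_chains m n s :
  (s \in chains m n) = [&& size s == m, path geq n s & all (leq 1) s].
Proof.
elim: m n s => [|m IH] n s /=; first by rewrite inE; case: s.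
apply/allpairsPdep/idP => [[k [t []]]|].
  rewrite mem_index_iota IH ltnS => /andP[k1 kn] /and3P[/eqP st pt at_] ->.
  by rewrite /= st eqxx kn k1 pt at_.
case: s => [|k s]//= /and3P[] /[!eqSS] st /andP[kn pt] /andP[k1 at_].
by exists k, s; rewrite mem_index_iota ltnS k1 kn IH st pt at_.
Qed.

Lemma chains_uniq m n : uniq (chains m n).
Proof.
elim: m n => [|m IH] n //=; apply: allpairs_uniq_dep => [||[k s] [l t] _ _ /=].
- exact: iota_uniq.
- by move=> k _; exact: IH.
- by case=> -> ->.
Qed.

Lemma sum_chains (F : pzSemiRingType) (ws : seq (nat -> nat -> F)) p n :
  \sum_(s <- chains (size ws) n) chain_prod ws p s = nest ws p n.
Proof.
elim: ws p n => [|w ws IH] p n /=; first by rewrite big_seq1.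
rewrite big_allpairs_dep; apply: eq_bigr => k _.
by rewrite -IH big_distrr.
Qed.

Lemma chain_prod_nth (F : comPzSemiRingType) (ws : seq (nat -> nat -> F)) p ks :
  size ks = size ws -> chain_prod ws p ks =
  \prod_(i < size ws) nth (fun _ _ => 1) ws i (nth 0%N (p :: ks) i) (nth 0%N ks i).
Proof.
elim: ws p ks => [|w ws IH] p [|k ks] //=; first by rewrite big_ord0.
by move=> [sk]; rewrite big_ord_recl/= IH.
Qed.

(** * The ratio of n!^2 to (n-k)!(n+k)! *)

(** The ratio n!^2 / ((n-k)! (n+k)!), as the product of the (n-j)/(n+j+1) over
    j < k; it vanishes for k > n. *)
Fixpoint cbin (F : fieldType) (n k : nat) : F :=
  if k is j.+1 then cbin F n j * (n - j)%:R / (n + k)%:R else 1.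

Lemma cbin_step (F : numFieldType) n k :
  (n + k.+1)%:R * cbin F n k.+1 = (n - k)%:R * cbin F n k.
Proof.
have ? : (n + k.+1)%:R != 0 :> F by rewrite pnatr_eq0 addnS.
by rewrite /=; field.
Qed.

Lemma cbin_eq0 (F : fieldType) n k : (n < k)%N -> cbin F n k = 0.
Proof.
elim: k => // k IH; rewrite ltnS leq_eqVlt => /predU1P[->|/IH h] /=.
  by rewrite subnn mulr0 mul0r.
by rewrite h !mul0r.
Qed.

(** It turns a difference in n into a factor k^2: n^2 (B(n,k) - B(n-1,k)) =
    k^2 B(n,k). *)
Lemma cbin_pred (F : numFieldType) n k :
  n.+1%:R ^+ 2 * cbin F n k = (n.+1%:R ^+ 2 - k%:R ^+ 2) * cbin F n.+1 k.
Proof.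
elim: k => [|k IH]; first by rewrite /= expr0n/= subr0.
have [nk|kn] := ltnP n k.+1; last first.
  have n1 : (n + k.+1)%:R != 0 :> F by rewrite pnatr_eq0 addnS.
  have n2 : (n.+1 + k.+1)%:R != 0 :> F by rewrite pnatr_eq0.
  rewrite /= !mulrA IH subSn 1?ltnW// !natrD -!natr1.
  rewrite natrB 1?ltnW//; field.
  by rewrite !natr1 -!natrD n1 n2.
rewrite cbin_eq0 // mulr0; have [->|kn] := eqVneq k n.
  by rewrite subrr mul0r.
by rewrite cbin_eq0 ?mulr0//; lia.
Qed.

Lemma cbin_ge0 (F : numFieldType) n k : 0 <= cbin F n k.
Proof. by elim: k => //= k IH; rewrite !mulr_ge0 ?invr_ge0. Qed.

Lemma cbin_le1 (F : numFieldType) n k : cbin F n k <= 1.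
Proof.
elim: k => //= k IH; rewrite -mulrA mulr_ile1 ?cbin_ge0 ?divr_ge0//.
by rewrite ler_pdivrMr ?mul1r ?ler_nat ?ltr0n; lia.
Qed.

(** Each factor (n-j)/(n+j+1) is at least 1 - (2j+1)/n, and the odd numbers
    2j+1 with j < k add up to k^2. *)
Lemma one_sub_cbin_le (F : numFieldType) n k : (0 < n)%N ->
  1 - cbin F n k <= k%:R ^+ 2 / n%:R.
Proof.
move=> n0; elim: k => [|k IH]; first by rewrite subrr expr0n/= mul0r.
have nn0 : n%:R != 0 :> F by rewrite pnatr_eq0 -lt0n.
have -> : k.+1%:R ^+ 2 / n%:R = k%:R ^+ 2 / n%:R + (k.*2.+1)%:R / n%:R :> F.
  by rewrite -mul2n -!natr1 natrM; field.
have n1 : (n + k.+1)%:R != 0 :> F by rewrite pnatr_eq0 addnS.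
have -> : 1 - cbin F n k.+1
    = 1 - cbin F n k + cbin F n k * (1 - (n - k)%:R / (n + k.+1)%:R).
  by rewrite /=; field.
apply: lerD => //.
have -> : 1 - (n - k)%:R / (n + k.+1)%:R
    = ((n + k.+1) - (n - k))%:R / (n + k.+1)%:R :> F.
  by rewrite [in RHS]natrB ?mulrBl ?divff//; lia.
apply: (@le_trans _ _ (1 * (((n + k.+1) - (n - k))%:R / (n + k.+1)%:R))).
  by apply: ler_wpM2r; rewrite ?cbin_le1// divr_ge0.
rewrite mul1r ler_pdivrMr ?ltr0n; last by lia.
rewrite mulrAC ler_pdivlMr ?ltr0n// -!natrM ler_nat.
have [kn|nk] := leqP k n; last by nia.
by apply: leq_mul; lia.
Qed.

(** Summation by parts: the coefficients of X k on both sides agree because k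
    B(n,k) + (k+1) B(n,k+1) = n (B(n,k) - B(n,k+1)), which is a form of
    [cbin_step]. *)
Lemma sum_cbin_even (F : numFieldType) n (X : nat -> F) : X 0 = 0 ->
  \sum_(1 <= k < n.+1) cbin F n k * k%:R * (X k + X k.-1)
  = n%:R * \sum_(1 <= k < n.+1) cbin F n k * (X k - X k.-1).
Proof.
move=> X0; apply/eqP; rewrite -subr_eq0 mulr_sumr -sumrB; apply/eqP.
(* The sum up to m telescopes to a boundary term, which vanishes at m = n. *)
suff H m : (m <= n)%N ->
  \sum_(1 <= k < m.+1) (cbin F n k * k%:R * (X k + X k.-1)
     - n%:R * (cbin F n k * (X k - X k.-1))) = (m%:R - n%:R) * cbin F n m * X m.
  by rewrite H// subrr !mul0r.
elim: m => [|m IH] mn; first by rewrite big_geq// X0 mulr0.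
rewrite big_nat_recr//= -/(cbin F n m.+1) IH 1?ltnW//.
have := cbin_step F n m; rewrite natrB 1?ltnW// natrD -!natr1 => E.
rewrite -[(m%:R - n%:R) * _]opprK -mulNr opprB -E -!/(cbin F n m.+1).
by set b := cbin F n m.+1; ring.
Qed.

(** The same summation by parts as in [sum_cbin_even], with alternating signs;
    it divides by n instead of multiplying. *)
Lemma sum_cbin_alt (F : numFieldType) n (X : nat -> F) : X 0 = 0 ->
  n%:R * (\sum_(1 <= k < n.+1) cbin F n k * (-1) ^+ k * (X k + X k.-1))
  = \sum_(1 <= k < n.+1) cbin F n k * ((-1) ^+ k * k%:R) * (X k - X k.-1).
Proof.
move=> X0; apply/eqP; rewrite -subr_eq0 mulr_sumr -sumrB; apply/eqP.
suff H m : (m <= n)%N ->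
  \sum_(1 <= k < m.+1) (n%:R * (cbin F n k * (-1) ^+ k * (X k + X k.-1))
     - cbin F n k * ((-1) ^+ k * k%:R) * (X k - X k.-1))
   = (-1) ^+ m * ((n%:R - m%:R) * cbin F n m) * X m.
  by rewrite H// subrr mul0r mulr0 mul0r.
elim: m => [|m IH] mn; first by rewrite big_geq// X0 mulr0.
rewrite big_nat_recr//= -/(cbin F n m.+1) IH 1?ltnW//.
have := cbin_step F n m; rewrite natrB 1?ltnW// natrD -!natr1 => E.
rewrite -E -!/(cbin F n m.+1) exprS.
by set b := cbin F n m.+1; ring.
Qed.

(** * Closed form of the truncated generating function *)

(** The i-th factor of the chain product, with e for delta_i, z for z_i, p for
    k_(i-1) and k for k_i. *)
Definition weight (F : fieldType) (e : nat) (z : F) (p k : nat) : F :=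
  (-1) ^+ (k * e) * k%:R ^ (e%:Z - 1) / (k%:R ^+ 2 - z ^+ 2) * 2 ^+ Delta p k.

(** An entry (c, z) stands for the pair (c_i, z_i). The exponent delta_i needs
    c_(i+1), the first component of the next entry; the default 0 plays the
    role of c_(d+1). *)
Fixpoint weights (F T : Type) (phi : nat -> T -> nat -> nat -> F)
    (l : seq (nat * T)) : seq (nat -> nat -> F) :=
  if l is (c, z) :: l' then
    phi (delta c + delta (head 0 (unzip1 l')))%N z :: weights phi l'
  else [::].

Lemma size_weights (F T : Type)
    (phi : nat -> T -> nat -> nat -> F) (l : seq (nat * T)) :
  size (weights phi l) = size l.
Proof. by elim: l => [|[c t] l IH] //=; rewrite IH. Qed.

(** The generating function of the zeta-star values with all indices at most
    n, defined by its recursion in n; z is z_0 and l lists the pairs (c_i,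
    z_i) for i >= 1. *)
Fixpoint gen_trunc (F : fieldType) (l : seq (nat * F)) (z : F) :=
  fix aux n := if n is n'.+1 then
      (aux n' + (if l is (c, y) :: l' then n%:R ^- c * gen_trunc l' y n else 0))
        / (1 - z ^+ 2 / n%:R ^+ 2)
    else (nilp l)%:R.

Lemma gen_truncS (F : fieldType) (l : seq (nat * F)) z n :
  gen_trunc l z n.+1 =
  (gen_trunc l z n
    + (if l is (c, y) :: l' then n.+1%:R ^- c * gen_trunc l' y n.+1 else 0))
        / (1 - z ^+ 2 / n.+1%:R ^+ 2).
Proof. by case: l. Qed.

Lemma gen_trunc0 (F : fieldType) (l : seq (nat * F)) z : gen_trunc l z 0 = (nilp l)%:R.
Proof. by case: l. Qed.

(** The factors 2^Delta double every term but the last, so they produce a sum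
    of two consecutive partial sums. *)
Lemma sum_Delta (F : fieldType) (x : nat -> F) k : (0 < k)%N ->
  \sum_(1 <= l < k.+1) 2 ^+ Delta k l * x l =
  \sum_(1 <= l < k.+1) x l + \sum_(1 <= l < k) x l.
Proof.
move=> k0.
have Dkk : Delta k k = 0%N by rewrite /Delta eqxx.
rewrite !big_nat_recr//= Dkk expr0 mul1r.
rewrite addrAC; congr (_ + _).
rewrite -big_split/=; apply: eq_big_nat => l /andP[_ lk].
by rewrite /Delta gtn_eqF// expr1 mulrDl mul1r.
Qed.

Lemma weight_pos (F : numFieldType) e (z : F) p k : (0 < k)%N ->
  weight e z p k = (-1) ^+ (k * e) * k%:R ^+ e / k%:R / (k%:R ^+ 2 - z ^+ 2)
     * 2 ^+ Delta p k.
Proof.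
move=> k0; rewrite /weight expfzDr ?pnatr_eq0 -?lt0n//.
by rewrite -exprnP exprN1 !mulrA.
Qed.

Lemma Delta0 k : (0 < k)%N -> Delta 0 k = 1%N.
Proof. by case: k. Qed.

(** The sum of the chain products with k_0 = k, when z is z_0 and l lists the
    pairs (c_i, z_i) for i >= 1. *)
Definition row_term (F : fieldType) (l : seq (nat * F)) (z : F) (k : nat) : F :=
  weight (delta 1 + delta (head 0 (unzip1 l)))%N z 0 k
    * nest (weights (@weight F) l) k k.

Definition off_squares (F : pzRingType) (z : F) :=
  forall k : nat, (0 < k)%N -> k%:R ^+ 2 - z ^+ 2 != 0.

(** The factor at k_1 in the product for (1, y) :: l and the factor at k_0 in
    the product for l have the same exponent, 1 + delta of the next entry;
    they differ only in the power of 2. *)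
Lemma row_term_one (F : numFieldType) (l : seq (nat * F)) z y k :
  off_squares z -> (0 < k)%N ->
  (k%:R ^+ 2 - z ^+ 2) * row_term ((1%N, y) :: l) z k
  = k%:R * \sum_(1 <= j < k.+1) 2 ^+ Delta k j * row_term l y j.
Proof.
move=> hz k0; have kn0 : k%:R != 0 :> F by rewrite pnatr_eq0 -lt0n.
have hzk := hz k k0.
rewrite /row_term weight_pos// /= {1 2}/delta/=.
rewrite mulnC exprM sqrrN expr1n expr1n mul1r Delta0// expr1.
rewrite !mulr_sumr; apply: eq_big_nat => j /andP[j0 _].
rewrite !weight_pos// (Delta0 j0) expr1; set a := _ ^+ (j * _).
set b := (_ - y ^+ 2)^-1.
rewrite -[delta 1%N]/(1%N) addn1; set e := j%:R ^+ _.
by field; rewrite ?(hzk, kn0, pnatr_eq0, gtn_eqF).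
Qed.

(** Here the factor at k_1 in the product for (3, y) :: l has exponent one
    less than the factor at k_0 in the product for l; the quotient is (-1)^j /
    j, up to the power of 2. *)
Lemma row_term_three (F : numFieldType) (l : seq (nat * F)) z y k :
  off_squares z -> (0 < k)%N ->
  (k%:R ^+ 2 - z ^+ 2) * row_term ((3%N, y) :: l) z k
  = (-1) ^+ k * \sum_(1 <= j < k.+1)
       2 ^+ Delta k j * ((-1) ^+ j / j%:R * row_term l y j).
Proof.
move=> hz k0; have kn0 : k%:R != 0 :> F by rewrite pnatr_eq0 -lt0n.
have hzk := hz k k0.
rewrite /row_term weight_pos// /= {1 2}/delta/= muln1 Delta0// expr1.
rewrite !mulr_sumr; apply: eq_big_nat => j /andP[j0 _].
have jn0 : j%:R != 0 :> F by rewrite pnatr_eq0 -lt0n.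
rewrite !weight_pos// (Delta0 j0) expr1 -[delta 1%N]/(1%N) -[delta 3%N]/(0%N).
rewrite add0n mulnDr muln1 !exprD !expr1.
have s1 : (-1) ^+ j * (-1) ^+ j = 1 :> F by rewrite -expr2 sqrr_sign.
rewrite -[LHS]mul1r -{1}s1.
set a := _ ^+ (j * _).
set b := (_ - y ^+ 2)^-1.
by field; rewrite hzk kn0 jn0.
Qed.

(** Partial sums up to m have the closed form (-1)^m (n-m) B(n,m) m (m+1) / (2
    (n-1)), which vanishes at m = n. *)
Lemma sum_cbin_sq (F : numFieldType) n : (1 < n)%N ->
  \sum_(1 <= k < n.+1) cbin F n k * ((-1) ^+ k * k%:R ^+ 2) = 0.
Proof.
move=> n1.
suff H m : (m <= n)%N -> 2 * (n%:R - 1) *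
    (\sum_(1 <= k < m.+1) cbin F n k * ((-1) ^+ k * k%:R ^+ 2))
    = (-1) ^+ m * ((n%:R - m%:R) * cbin F n m) * m%:R * (m%:R + 1).
  have := H n (leqnn n); rewrite subrr mul0r mulr0 !mul0r => /eqP.
  rewrite !mulf_eq0 pnatr_eq0/= subr_eq0 (eqr_nat F n 1) gtn_eqF//=.
  by move/eqP.
elim: m => [|m IH] mn; first by rewrite big_geq// !mulr0 mul0r.
rewrite big_nat_recr//= -/(cbin F n m.+1) mulrDr IH 1?ltnW//.
have := cbin_step F n m; rewrite natrB 1?ltnW// natrD -!natr1 => E.
rewrite -E -!/(cbin F n m.+1) exprS.
by set b := cbin F n m.+1; ring.
Qed.

(** The left-hand side of the recursion for the generating function, applied
    to a sum against B(n,k): by [cbin_pred] the coefficients of y k combine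
    into k^2 - z^2. *)
Lemma sum_cbin_pred (F : numFieldType) (z : F) (y : nat -> F) n :
  (1 - z ^+ 2 / n.+1%:R ^+ 2) * (\sum_(1 <= k < n.+2) cbin F n.+1 k * y k)
    - \sum_(1 <= k < n.+1) cbin F n k * y k
  = n.+1%:R ^- 2 * \sum_(1 <= k < n.+2)
        cbin F n.+1 k * ((k%:R ^+ 2 - z ^+ 2) * y k).
Proof.
have n0 : n.+1%:R != 0 :> F by rewrite pnatr_eq0.
set P := \sum_(1 <= _ < n.+1) _.
have -> : P = \sum_(1 <= k < n.+2) cbin F n k * y k.
  rewrite [RHS]big_nat_recr//= -/(cbin F n n.+1).
  by rewrite (cbin_eq0 _ (ltnSn n)) mul0r addr0.
rewrite !mulr_sumr -sumrB; apply: eq_bigr => k _.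
have := cbin_pred F n k; set b := cbin F n k; set b' := cbin F n.+1 k.
move=> Eb; have -> : b = (n.+1%:R ^+ 2 - k%:R ^+ 2) * b' / n.+1%:R ^+ 2.
  by rewrite -Eb mulrC mulKf// expf_neq0.
by field.
Qed.

Lemma gen_trunc_factor_neq0 (F : numFieldType) (z : F) n :
  off_squares z -> 1 - z ^+ 2 / n.+1%:R ^+ 2 != 0.
Proof.
move=> hz; have n0 : n.+1%:R != 0 :> F by rewrite pnatr_eq0.
suff -> : 1 - z ^+ 2 / n.+1%:R ^+ 2 = (n.+1%:R ^+ 2 - z ^+ 2) / n.+1%:R ^+ 2.
  by rewrite mulf_neq0 ?hz// invr_eq0 expf_neq0.
by field; rewrite nat1r.
Qed.

(** The start of the induction. All exponents reduce to delta_0 = 3, and the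
    recursion without tail amounts to [sum_cbin_sq]. *)
Lemma gen_trunc_nilE (F : numFieldType) (z : F) n : off_squares z ->
  gen_trunc [::] z n.+1 = - \sum_(1 <= k < n.+2) cbin F n.+1 k * row_term [::] z k.
Proof.
move=> hz.
have rE k : (0 < k)%N ->
    (k%:R ^+ 2 - z ^+ 2) * row_term [::] z k = 2 * ((-1) ^+ k * k%:R ^+ 2).
  case: k => // k _; rewrite /row_term weight_pos// Delta0// expr1 /= mulr1.
  rewrite -[(delta 1 + _)%N]/3%N mulnC exprM -[(-1) ^+ 3]signr_odd/= expr1.
  by field; rewrite nat1r hz// pnatr_eq0.
elim: n => [|n IHn]; rewrite gen_truncS addr0;
  apply: (canLR (mulfK (gen_trunc_factor_neq0 _ hz))).
  have := rE 1%N isT; rewrite !expr1n expr1 mulr1 mulrN1 => r1.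
  rewrite big_nat1 gen_trunc0 /= subn0 mulr1 mul1r divr1.
  rewrite mulrC mulrN mulrCA r1 mulrN opprK mulVf// pnatr_eq0.
apply/eqP; rewrite IHn mulNr eqr_opp eq_sym [_ * (1 - _)]mulrC -subr_eq0.
rewrite sum_cbin_pred.
rewrite (eq_big_nat _ _ (F2 := fun k =>
   2 * (cbin F n.+2 k * ((-1) ^+ k * k%:R ^+ 2)))).
  by rewrite -mulr_sumr sum_cbin_sq// !mulr0.
by move=> k /andP[k0 _]; rewrite rE// mulrCA.
Qed.

(** The finite form of the theorem. After [sum_cbin_pred] the induction step
    asks to multiply or divide by n a sum against B(n,k), which
    [sum_cbin_even] and [sum_cbin_alt] do. For empty l and n = 0 the left side
    is 1, hence the side condition. *)
Lemma gen_truncE (F : numFieldType) (l : seq (nat * F)) z n :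
  all (mem [:: 1; 3]%N) (unzip1 l) -> off_squares z ->
  (forall y, y \in unzip2 l -> off_squares y) -> (nilp l ==> (0 < n))%N ->
  gen_trunc l z n = - \sum_(1 <= k < n.+1) cbin F n k * row_term l z k.
Proof.
elim: l z n => [|[c y] l IH] z n.
  by case: n => // n _ hz _ _; exact: gen_trunc_nilE.
move=> /andP[c13 l13] hz hl _; rewrite [unzip2 _]/= in hl.
elim: n => [|n IHn]; first by rewrite big_geq// oppr0.
have n0 : n.+1%:R != 0 :> F by rewrite pnatr_eq0.
rewrite gen_truncS IHn IH//; first last.
- by rewrite implybT.
- by move=> w wl; apply: hl; rewrite inE wl orbT.
- by apply: hl; rewrite inE eqxx.
apply: (canLR (mulfK (gen_trunc_factor_neq0 _ hz))); apply/eqP.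
rewrite mulrN -opprD mulNr eqr_opp [_ * (1 - _)]mulrC addrC eq_sym -subr_eq.
rewrite sum_cbin_pred; apply/eqP.
have : c \in [:: 1%N; 3%N] by [].
rewrite !inE => /orP[] /eqP ->.
  pose X k := \sum_(1 <= j < k.+1) row_term l y j.
  have X0 : X 0 = 0 by rewrite /X big_geq.
  rewrite (eq_big_nat _ _ (F2 := fun k => cbin F n.+1 k * k%:R * (X k + X k.-1))).
    rewrite (sum_cbin_even _ X0) mulrA; congr (_ * _); first by field; rewrite nat1r.
    apply: eq_big_nat => k /andP[k0 _]; rewrite /X prednK// big_nat_recr//=.
    by rewrite addrAC subrr add0r.
  by move=> k /andP[k0 _]; rewrite row_term_one// sum_Delta// /X prednK//; ring.
pose x j := (-1) ^+ j / j%:R * row_term l y j.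
pose X k := \sum_(1 <= j < k.+1) x j.
have X0 : X 0 = 0 by rewrite /X big_geq.
rewrite (eq_big_nat _ _ (F2 := fun k => cbin F n.+1 k * (-1) ^+ k * (X k + X k.-1))).
  have -> : n.+1%:R ^- 2 = n.+1%:R ^- 3 * n.+1%:R :> F by field; rewrite nat1r.
  rewrite -mulrA (sum_cbin_alt _ X0); congr (_ * _).
  apply: eq_big_nat => k /andP[k0 _]; rewrite /X prednK// big_nat_recr//=.
  rewrite addrAC subrr add0r /x.
  have kn0 : k%:R != 0 :> F by rewrite pnatr_eq0 -lt0n.
  have s1 : (-1) ^+ k * (-1) ^+ k = 1 :> F by rewrite -expr2 sqrr_sign.
  rewrite -mulrA; congr (_ * _).
  transitivity ((-1) ^+ k * (-1) ^+ k * row_term l y k); first by field.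
  by rewrite s1 mul1r.
by move=> k /andP[k0 _]; rewrite row_term_three// sum_Delta// /X prednK//; ring.
Qed.

(** * Expansion of the truncated generating function in powers of the
    variables *)

(** Truncating by the total degree, rather than in each variable, is what
    makes [gen_deg_rec] exact. *)
Fixpoint tuples_below (m N : nat) : seq (seq nat) :=
  if m is m'.+1 then [seq a :: s | a <- iota 0 N, s <- tuples_below m' (N - a)]
  else nseq (0 < N)%N [::].

Lemma mem_tuples_below m N s :
  (s \in tuples_below m N) = (size s == m) && (sumn s < N)%N.
Proof.
elim: m N s => [|m IH] N s /=.
  by rewrite mem_nseq; case: s => [|a s] /=; rewrite ?andbF ?eqxx ?andbT//; case: N.
apply/allpairsPdep/idP => [[k [t []]]|].
  rewrite mem_iota IH => /andP[_ kN] /andP[/eqP st tN] ->.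
  by rewrite /= st eqxx; lia.
case: s => [|k s]//= /andP[] /[!eqSS] st kN.
by exists k, s; rewrite mem_iota IH st; split => //; lia.
Qed.

Lemma tuples_below_uniq m N : uniq (tuples_below m N).
Proof.
elim: m N => [|m IH] N /=; first by case: N.
apply: allpairs_uniq_dep => [||[k s] [l t] _ _ /=].
- exact: iota_uniq.
- by move=> k _; exact: IH.
- by case=> -> ->.
Qed.

Arguments tuples_below : simpl never.

Definition incr_head (a : seq nat) := (head 0%N a).+1 :: behead a.

Lemma sum_tuples_below_rec (V : nmodType) m N (f : seq nat -> V) :
  \sum_(a <- tuples_below m.+1 N.+1) f a =
  \sum_(s <- tuples_below m N.+1) f (0%N :: s)
  + \sum_(a <- tuples_below m.+1 N) f (incr_head a).
Proof.
have cS M : tuples_below m.+1 M =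
  [seq a :: s | a <- iota 0 M, s <- tuples_below m (M - a)] by [].
rewrite !cS !big_allpairs_dep [iota 0 N.+1]/= big_cons subn0; congr (_ + _).
by rewrite -[1%N]addn0 iotaDl big_map.
Qed.

Fixpoint zeta_part (F : fieldType) (s : seq nat) (n : nat) : F :=
  if s is e :: s' then \sum_(1 <= k < n.+1) k%:R ^- e * zeta_part F s' k else 1.

Lemma zeta_partS (F : fieldType) e s n :
  zeta_part F (e :: s) n.+1 =
  zeta_part F (e :: s) n + n.+1%:R ^- e * zeta_part F s n.+1.
Proof. by rewrite /= big_nat_recr. Qed.

Lemma zeta_part0 (F : fieldType) e s : zeta_part F (e :: s) 0 = 0.
Proof. by rewrite /= big_geq. Qed.

Arguments zeta_part : simpl never.

Definition monomial (F : pzSemiRingType) (zs : seq F) (a : seq nat) : F :=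
  \prod_(p <- zip zs a) p.1 ^+ (2 * p.2).

(** The part of [gen_trunc] of total degree less than N in the exponents a_0,
    ..., a_d. *)
Definition gen_deg (F : fieldType) (l : seq (nat * F)) (z : F) (n N : nat) : F :=
  \sum_(a <- tuples_below (size l).+1 N)
    zeta_part F (insert_twos (unzip1 l) a) n * monomial (z :: unzip2 l) a.

(** Tuples with a_0 > 0 give the terms with z^2, where the total degree drops
    by one; tuples with a_0 = 0 give the terms of the tail of l. *)
Lemma gen_deg_rec (F : fieldType) (l : seq (nat * F)) z n N :
  gen_deg l z n.+1 N.+1 =
  gen_deg l z n N.+1 + z ^+ 2 / n.+1%:R ^+ 2 * gen_deg l z n.+1 N
  + (if l is (c, y) :: l' then n.+1%:R ^- c * gen_deg l' y n.+1 N.+1 else 0).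
Proof.
rewrite /gen_deg !sum_tuples_below_rec.
have -> : \sum_(a <- tuples_below (size l).+1 N)
      zeta_part F (insert_twos (unzip1 l) (incr_head a)) n.+1
      * monomial (z :: unzip2 l) (incr_head a)
   = \sum_(a <- tuples_below (size l).+1 N)
      zeta_part F (insert_twos (unzip1 l) (incr_head a)) n
      * monomial (z :: unzip2 l) (incr_head a)
   + z ^+ 2 / n.+1%:R ^+ 2 * \sum_(a <- tuples_below (size l).+1 N)
    zeta_part F (insert_twos (unzip1 l) a) n.+1 * monomial (z :: unzip2 l) a.
  rewrite mulr_sumr -big_split/=; apply: eq_big_seq => -[|a s].
    by rewrite mem_tuples_below.
  move=> _; rewrite /insert_twos/= -/(nseq a 2%N) zeta_partS mulrDl; congr (_ + _).
  rewrite /monomial/= !big_cons/= mulnS exprD; ring.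
rewrite [X in X + _ = _](_ : _ =
    \sum_(s <- tuples_below (size l) N.+1)
     zeta_part F (insert_twos (unzip1 l) (0%N :: s)) n
     * monomial (z :: unzip2 l) (0%N :: s)
    + (if l is (c, y) :: l' then n.+1%:R ^- c * gen_deg l' y n.+1 N.+1 else 0)).
  by rewrite -!addrA; congr (_ + _); rewrite addrC -addrA.
case: l => [|[c y] l] /=; first by rewrite addr0 !big_seq1.
rewrite mulr_sumr -big_split/=; apply: eq_big_seq => -[|a s].
  by rewrite mem_tuples_below.
move=> _; rewrite /insert_twos/= -/(nseq a 2%N) zeta_partS mulrDl; congr (_ + _).
by rewrite mulrA; congr (_ * _); rewrite /monomial/= big_cons/= muln0 mul1r.
Qed.

Lemma gen_deg0 (F : fieldType) (l : seq (nat * F)) z n : gen_deg l z n 0 = 0.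
Proof. by rewrite /gen_deg/= big_nil. Qed.

Lemma gen_deg_empty (F : fieldType) (l : seq (nat * F)) z N :
  gen_deg l z 0 N.+1 = (nilp l)%:R.
Proof.
rewrite /gen_deg; case: l => [|[c y] l].
  rewrite sum_tuples_below_rec/= [X in _ + X]big1_seq ?addr0.
    by rewrite big_seq1 /monomial /insert_twos/= big_seq1 muln0 mulr1.
  case=> [|a [|b s]]; rewrite ?mem_tuples_below//= => _.
  by rewrite /insert_twos/= zeta_part0 mul0r.
rewrite big1_seq// => -[|[|a] [|b s]]; rewrite ?mem_tuples_below//= => _;
  by rewrite /insert_twos/= zeta_part0 mul0r.
Qed.

Definition gen_tail (F : fieldType) (l : seq (nat * F)) (n : nat) : F :=
  if l is (c, y) :: l' then n%:R ^- c * gen_trunc l' y n else 0.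

Definition gen_deg_tail (F : fieldType) (l : seq (nat * F)) (n N : nat) : F :=
  if l is (c, y) :: l' then n%:R ^- c * gen_deg l' y n N else 0.

(** The difference D(n, N) between the generating function and its part of
    degree < N satisfies D(n+1, N+1) = a D(n+1, N) + D(n, N+1) + (difference
    of the tails) with a = z^2/(n+1)^2, and |a| is at most th times
    r^2/(n+1)^2. *)
Lemma gen_deg_error_step (F : numFieldType) (l l' : seq (nat * F)) (z th r : F) :
  0 <= th <= 1 -> 0 <= r < 1 -> `|z| ^+ 2 <= th * r ^+ 2 -> nilp l = nilp l' ->
  (forall n N, `|gen_tail l n - gen_deg_tail l n N| <= th ^+ N * gen_tail l' n) ->
  forall n N, `|gen_trunc l z n - gen_deg l z n N| <= th ^+ N * gen_trunc l' r n.
Proof.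
move=> /andP[th0 th1] /andP[r0 r1] zr ll' tail_le.
pose b n : F := r ^+ 2 / n.+1%:R ^+ 2.
have b0 n : 0 <= b n by rewrite divr_ge0 ?exprn_ge0.
have b1 n : 0 < 1 - b n.
  rewrite subr_gt0 /b ltr_pdivrMr ?exprn_gt0 ?ltr0n// mul1r.
  by rewrite ltrXn2r// (lt_le_trans r1)// ler1n.
pose a n : F := z ^+ 2 / n.+1%:R ^+ 2.
have ab n : `|a n| <= th * b n.
  rewrite /a /b normrM normfV !normrX (ger0_norm (ler0n F _)) mulrA.
  by apply: ler_wpM2r; rewrite ?invr_ge0 ?exprn_ge0.
(* Since th <= 1, dividing by 1 - a n costs no more than dividing by 1 - b n. *)
have a1 n : 1 - b n <= `|1 - a n|.
  rewrite -[X in X - b n](@normr1 F); apply: le_trans (lerB_dist _ _).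
  by rewrite lerD2l lerN2 (le_trans (ab n))// ler_piMl.
have g0 n : 0 <= gen_trunc l' r n.
  elim: n => [|n IH]; first by rewrite gen_trunc0.
  rewrite gen_truncS; apply: divr_ge0; last exact/ltW/b1.
  rewrite addr_ge0// -/(gen_tail l' n.+1).
  by have := le_trans (normr_ge0 _) (tail_le n.+1 0%N); rewrite expr0 mul1r.
have a0 n : 1 - a n != 0 by rewrite -normr_gt0 (lt_le_trans (b1 n)).
have genSl n : gen_trunc l z n.+1
    = a n * gen_trunc l z n.+1 + gen_trunc l z n + gen_tail l n.+1.
  have E : gen_trunc l z n.+1 * (1 - a n) = gen_trunc l z n + gen_tail l n.+1.
    by rewrite gen_truncS -/(a n) divfK.
  by rewrite -addrA -E; ring.
have genSl' n : gen_trunc l' r n.+1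
    = b n * gen_trunc l' r n.+1 + gen_trunc l' r n + gen_tail l' n.+1.
  have E : gen_trunc l' r n.+1 * (1 - b n) = gen_trunc l' r n + gen_tail l' n.+1.
    by rewrite gen_truncS -/(b n) divfK// gt_eqF.
  by rewrite -addrA -E; ring.
have tail0 n : gen_deg_tail l n 0 = 0.
  by case: (l) => [|[c y] l1]//=; rewrite gen_deg0 mulr0.
elim=> [|n IHn] N.
  case: N => [|N]; rewrite ?gen_deg0 ?gen_deg_empty !gen_trunc0 ll'.
    by rewrite subr0 expr0 mul1r ger0_norm.
  by rewrite subrr normr0 mulr_ge0 ?exprn_ge0.
elim: N => [|N IHN].
  rewrite gen_deg0 subr0 expr0 mul1r !gen_truncS normrM normfV.
  have := IHn 0%N; rewrite gen_deg0 subr0 expr0 mul1r => IHn0.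
  have := tail_le n.+1 0%N; rewrite tail0 subr0 expr0 mul1r => tail_le0.
  apply: ler_pM; rewrite ?invr_ge0//.
    by rewrite (le_trans (ler_normD _ _))// lerD.
  by rewrite lef_pV2 ?posrE ?(b1 n) ?a1// (lt_le_trans (b1 n)).
have -> : gen_trunc l z n.+1 - gen_deg l z n.+1 N.+1 =
    a n * (gen_trunc l z n.+1 - gen_deg l z n.+1 N)
    + (gen_trunc l z n - gen_deg l z n N.+1)
    + (gen_tail l n.+1 - gen_deg_tail l n.+1 N.+1).
  by rewrite {1}genSl gen_deg_rec -/(gen_deg_tail l n.+1 N.+1) -/(a n); ring.
rewrite genSl' !mulrDr; apply: le_trans (ler_normD _ _) (lerD _ (tail_le _ _)).
apply: le_trans (ler_normD _ _) (lerD _ (IHn _)).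
rewrite -mulrDr normrM.
apply: le_trans (ler_pM _ _ (ab n) IHN) _ => //.
by rewrite exprS le_eqVlt; apply/orP; left; apply/eqP; ring.
Qed.

(** The part of total degree at least N gains a factor th^N when each variable
    shrinks from r to modulus at most sqrt(th) r. For N = 0 the bound says
    that the generating function at z is dominated by the one at r. *)
Lemma gen_deg_error (F : numFieldType) (l : seq (nat * F)) (z th r : F) n N :
  0 <= th <= 1 -> 0 <= r < 1 -> `|z| ^+ 2 <= th * r ^+ 2 ->
  all (fun y => `|y| ^+ 2 <= th * r ^+ 2) (unzip2 l) ->
  `|gen_trunc l z n - gen_deg l z n N|
    <= th ^+ N * gen_trunc [seq (p.1, r) | p <- l] r n.
Proof.
move=> th01 r01; elim: l z n N => [|[c y] l IH] z n N zr.
  move=> _; apply: gen_deg_error_step => // k M.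
  by rewrite subrr normr0 mulr0.
move=> /andP[yr lr]; apply: gen_deg_error_step => // k M /=.
rewrite -mulrBr normrM mulrCA ger0_norm ?invr_ge0 ?exprn_ge0//.
by rewrite ler_wpM2l ?IH// invr_ge0 exprn_ge0.
Qed.

(** * Absolute bounds *)

Definition harm (F : fieldType) (n : nat) : F := \sum_(1 <= k < n.+1) k%:R^-1.

Lemma harmS (F : fieldType) n : harm F n.+1 = harm F n + n.+1%:R^-1.
Proof. by rewrite /harm big_nat_recr. Qed.

Lemma harm_ge0 (F : realFieldType) n : 0 <= harm F n.
Proof. by rewrite sumr_ge0// => k _; rewrite invr_ge0. Qed.

Lemma harm_le (F : realFieldType) n : harm F n <= n%:R.
Proof.
elim: n => [|n IH]; first by rewrite /harm big_geq.
by rewrite harmS -[leRHS]natr1 lerD// invf_le1 ?ler1n ?ltr0n.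
Qed.

(** The sum telescopes against 4 - (H_n + 2)/n. *)
Lemma sum_harm_sq (F : realFieldType) n :
  \sum_(1 <= k < n.+1) harm F k / k%:R ^+ 2 <= 4.
Proof.
case: n => [|n]; first by rewrite big_geq.
suff H : \sum_(1 <= k < n.+2) harm F k / k%:R ^+ 2
    <= 4 - (harm F n.+1 + 2) / n.+1%:R.
  by apply: le_trans H _; rewrite gerBl divr_ge0// addr_ge0// harm_ge0.
elim: n => [|n IH].
  by rewrite big_nat1 harmS /harm big_geq// expr1n !divr1 add0r; lra.
rewrite big_nat_recr//=; apply: le_trans (lerD IH (lexx _)) _.
rewrite (harmS _ n.+1); set h := harm F n.+1.
have n1 : n.+1%:R != 0 :> F by rewrite pnatr_eq0.
have n2 : n.+2%:R != 0 :> F by rewrite pnatr_eq0.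
set x : F := n.+1%:R^-1; set y : F := n.+2%:R^-1.
have xy : x - y = x * y.
  by rewrite /x /y -[n.+2%:R]natr1; field; rewrite nat1r natr1 n2 n1.
have y0 : 0 <= y by rewrite invr_ge0.
have y1 : y <= 1 by rewrite invf_le1 ?ler1n ?ltr0n.
have yx : y <= x by rewrite lef_pV2 ?posrE ?ltr0n// ler_nat.
have h0 : 0 <= h := harm_ge0 F n.+1.
rewrite -subr_ge0 -exprVn -/y.
have -> : 4 - (h + y + 2) * y - (4 - (h + 2) * x + (h + y) * y ^+ 2)
    = y * ((h + 2) * (x - y) + y * (1 - y)).
  (* As x and y are consecutive reciprocals, x - y = x y; one use of this
     gives the product form. *)
  transitivity ((h + 2) * (x - y) - y ^+ 2 - (h + y) * y ^+ 2); first by ring.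
  by rewrite {1}xy; ring.
by rewrite mulr_ge0// addr_ge0// mulr_ge0 ?subr_ge0// addr_ge0.
Qed.

(** A majorant of [weight] that is uniform in z, once C accounts for a common
    bound on the moduli. It keeps an argument in the place of z, so that
    [weights] builds both from the same list. *)
Definition weight_bound (F : fieldType) (T : Type) (C : F) (e : nat) (_ : T)
    (p k : nat) : F := C * k%:R ^+ e / k%:R ^+ 3.

(** The order of growth of the nested sum that starts with the entry c: linear
    for c = 1 and logarithmic for c = 3; the value at c = 0 is for the empty
    sum. *)
Definition growth (F : fieldType) (c n : nat) : F :=
  if c == 0%N then 1 else if c == 1%N then n%:R else harm F n.

(** One estimate for the three values of c, so that the induction for nested
    sums does not depend on which entry comes next. *)
Lemma growth_le (F : realFieldType) c k : c \in [:: 0; 1; 3]%N -> (0 < k)%N ->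
  k%:R ^+ delta c * growth F c k <= k%:R ^+ 2.
Proof.
rewrite !inE => /or3P[] /eqP -> k0; rewrite /growth /delta/=.
- by rewrite mulr1.
- by [].
- rewrite mul1r (le_trans (harm_le _ _))// expr2 ler_peMr// ler1n//.
Qed.

Lemma nest_bound_ge0 (F : realFieldType) T (C : F) (l : seq (nat * T)) p n :
  0 <= C -> 0 <= nest (weights (@weight_bound F T C) l) p n.
Proof.
move=> C0; elim: l p n => [|[c y] l IH] p n /=; first by [].
by rewrite sumr_ge0// => k _; rewrite mulr_ge0// divr_ge0 ?mulr_ge0 ?exprn_ge0.
Qed.

Lemma nest_bound_step (F : realFieldType) T (C A : F) c y (l : seq (nat * T)) p n :
  0 <= C -> 0 <= A ->
  head 0%N (unzip1 l) \in [:: 0; 1; 3]%N ->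
  (forall p n, nest (weights (@weight_bound F T C) l) p n
      <= A * growth F (head 0%N (unzip1 l)) n) ->
  nest (weights (@weight_bound F T C) ((c, y) :: l)) p n
    <= C * A * \sum_(1 <= k < n.+1) k%:R ^+ delta c / k%:R.
Proof.
move=> C0 A0 hl IH /=; rewrite mulr_sumr; apply: ler_sum_nat => k /andP[k0 _].
apply: le_trans (ler_wpM2l _ (IH k k)) _.
  by rewrite divr_ge0 ?mulr_ge0 ?exprn_ge0.
have kn0 : k%:R != 0 :> F by rewrite pnatr_eq0 -lt0n.
have := growth_le F hl k0; set g := growth _ _ _; set h := head _ _ => gle.
rewrite /weight_bound exprD.
have -> : C * (k%:R ^+ delta c * k%:R ^+ delta h) / k%:R ^+ 3 * (A * g)
  = C * A * (k%:R ^+ delta c / k%:R ^+ 3) * (k%:R ^+ delta h * g) by ring.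
have -> : C * A * (k%:R ^+ delta c / k%:R)
  = C * A * (k%:R ^+ delta c / k%:R ^+ 3) * k%:R ^+ 2 by field.
by rewrite ler_wpM2l// mulr_ge0 ?mulr_ge0 ?divr_ge0 ?exprn_ge0.
Qed.

Lemma nest_bound_growth (F : realFieldType) T (C : F) (l : seq (nat * T)) :
  0 <= C -> all (mem [:: 1; 3]%N) (unzip1 l) ->
  exists2 A : F, 0 <= A & forall p n,
    nest (weights (@weight_bound F T C) l) p n
      <= A * growth F (head 0%N (unzip1 l)) n.
Proof.
move=> C0; elim: l => [|[c y] l IH].
  by exists 1 => // p n /=; rewrite /growth/= mulr1.
move=> /andP[c13 l13]; have [A A0 HA] := IH l13.
have hl : head 0%N (unzip1 l) \in [:: 0; 1; 3]%N.
  by case: (l) l13 => [|[c' y'] l'] //= /andP[h _]; rewrite inE orbC h.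
exists (C * A) => [|p n]; first by rewrite mulr_ge0.
apply: le_trans (nest_bound_step c y p n C0 A0 hl HA) _.
rewrite ler_wpM2l ?mulr_ge0// le_eqVlt; apply/orP; left; apply/eqP.
have : c \in [:: 1%N; 3%N] by [].
rewrite !inE => /orP[] /eqP -> /=; rewrite /growth /delta/=.
  rewrite (eq_big_nat _ _ (F2 := fun=> 1)) ?big_const_nat ?iter_addr_0 ?subn1//.
  by move=> k /andP[k0 _]; rewrite expr1 divff// pnatr_eq0 -lt0n.
by apply: eq_bigr => k _; rewrite expr0 mul1r.
Qed.

(** As the first entry after c_0 = 1 is a 3, the inner sums are O(H_k) and the
    outer terms O(H_k / k^2). *)
Lemma nest_bound_bounded (F : realFieldType) T (C : F) x y (l : seq (nat * T)) :
  0 <= C -> all (mem [:: 1; 3]%N) (unzip1 l) ->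
  exists K : F, forall n,
    nest (weights (@weight_bound F T C) [:: (1%N, x), (3%N, y) & l]) 0 n <= K.
Proof.
move=> C0 l13; have [A A0 HA] := @nest_bound_growth F T C ((3%N, y) :: l) C0 l13.
exists (C * A * 4) => n; apply: le_trans _ (ler_wpM2l _ (sum_harm_sq F n)); last first.
  by rewrite mulr_ge0.
rewrite mulr_sumr [nest _ _ _]/=; apply: ler_sum_nat => k /andP[k0 _].
apply: le_trans (ler_wpM2l _ (HA k k)) _.
  by rewrite divr_ge0 ?mulr_ge0 ?exprn_ge0.
have kn0 : k%:R != 0 :> F by rewrite pnatr_eq0 -lt0n.
rewrite /weight_bound /growth /= -[delta 1]/1%N -[delta 3]/0%N.
by rewrite le_eqVlt; apply/orP; left; apply/eqP; field.
Qed.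

(** Uses |k^2 - z^2| >= k^2 (1 - rho^2) for k >= 1. *)
Lemma weight_le (F : numFieldType) e (z rho : F) p k :
  `|z| <= rho -> rho < 1 -> (0 < k)%N ->
  `|weight e z p k| <= 2 / (1 - rho ^+ 2) * k%:R ^+ e / k%:R ^+ 3.
Proof.
move=> zr r1 k0; have rho0 : 0 <= rho := le_trans (normr_ge0 _) zr.
have kp : 0 < k%:R :> F by rewrite ltr0n.
have r21 : 0 < 1 - rho ^+ 2 by rewrite subr_gt0 expr_lt1.
rewrite weight_pos// !normrM !normfV !normrX normrN1 expr1n mul1r !normr_nat.
have dk : k%:R ^+ 2 * (1 - rho ^+ 2) <= `|k%:R ^+ 2 - z ^+ 2|.
  apply: le_trans (lerB_dist _ _); rewrite !normrX normr_nat mulrBr mulr1.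
  rewrite lerD2l lerN2 (le_trans (lerXn2r 2 _ _ zr)) ?nnegrE//.
  by rewrite ler_peMl ?exprn_ge0// exprn_ege1// ler1n.
have dk0 : 0 < k%:R ^+ 2 * (1 - rho ^+ 2) by rewrite mulr_gt0 ?exprn_gt0.
have -> : 2 / (1 - rho ^+ 2) * k%:R ^+ e / k%:R ^+ 3
   = k%:R ^+ e / k%:R / (k%:R ^+ 2 * (1 - rho ^+ 2)) * 2.
  by field; rewrite !gt_eqF.
apply: ler_pM => //.
  rewrite ler_wpM2l ?divr_ge0 ?exprn_ge0// lef_pV2 ?posrE//.
  exact: lt_le_trans dk.
by rewrite /Delta; case: ifP; rewrite ?expr0 ?expr1 ?ler1n.
Qed.

Lemma weight_le_morph (K : realFieldType) (F : numFieldType)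
    (i : {rmorphism K -> F}) (rho : K) T (t : T) e (z : F) p k :
  `|z| <= i rho -> i rho < 1 -> (0 < k)%N ->
  `|weight e z p k| <= i (weight_bound (2 / (1 - rho ^+ 2)) e t p k).
Proof.
rewrite /weight_bound !(rmorphM, fmorphV, rmorphXn, rmorphB, rmorph1, rmorph_nat).
exact: weight_le.
Qed.

Lemma chain_prod_le (K : realFieldType) (F : numFieldType)
    (i : {rmorphism K -> F}) (rho : K)
    (l : seq (nat * F)) p s :
  i rho < 1 -> all (fun y => `|y| <= i rho) (unzip2 l) -> all (leq 1) s ->
  `|chain_prod (weights (@weight F) l) p s|
   <= i (chain_prod (weights (@weight_bound K F (2 / (1 - rho ^+ 2))) l) p s).
Proof.
move=> r1; elim: l p s => [|[c y] l IH] p s /=.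
  by move=> _ _; case: s => *; rewrite normr1 rmorph1.
move=> /andP[yr lr]; case: s => [|k s] /=; first by rewrite normr1 rmorph1.
move=> /andP[k0 s0]; rewrite normrM rmorphM ler_pM ?IH//.
exact: weight_le_morph.
Qed.

Lemma nest_le (K : realFieldType) (F : numFieldType)
    (i : {rmorphism K -> F}) (rho : K)
    (l : seq (nat * F)) p n :
  i rho < 1 -> all (fun y => `|y| <= i rho) (unzip2 l) ->
  `|nest (weights (@weight F) l) p n|
   <= i (nest (weights (@weight_bound K F (2 / (1 - rho ^+ 2))) l) p n).
Proof.
move=> r1 lr; rewrite -!sum_chains rmorph_sum !size_weights.
apply: le_trans (ler_norm_sum _ _ _) _.
rewrite big_seq [leRHS]big_seq; apply: ler_sum => s.
by rewrite mem_chains => /and3P[_ _ s1]; exact: chain_prod_le.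
Qed.

(** * Limits and unconditional sums *)

Lemma complex_cvgP (R : realType) (T : Type) (F : set_system T) (FF : Filter F)
    (f : T -> R[i]^o) (L : R[i]^o) :
  f @ F --> L <->
  (forall e : R, 0 < e -> \forall x \near F, `|L - f x| <= (e%:C : R[i])).
Proof.
split=> [/cvgrPdist_le fL e e0|fL].
  by apply: fL; rewrite ltcR.
apply/cvgrPdist_le => e; rewrite ltcE => /andP[/eqP/= e0 re0].
have -> : e = (complex.Re e)%:C by case: e e0 {re0} => a b /= ->.
exact: fL.
Qed.

Lemma nondecreasing_bounded_cvg (R : realType) (T : nat -> R) (K : R) :
  {homo T : n m / (n <= m)%N >-> n <= m} -> (forall n, T n <= K) ->
  exists2 t : R, T @ \oo --> t & forall n, T n <= t.
Proof.
move=> Tnd TK; have Tc : cvgn T.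
  by apply: nondecreasing_is_cvgn => //; exists K => _ [n _ <-].
by exists (limn T) => // n; exact: nondecreasing_cvgn_le.
Qed.

(** The sequence u + T is nondecreasing and bounded, hence u is a difference
    of two convergent sequences. *)
Lemma dominated_cvg (R : realType) (T : nat -> R) (u : nat -> R) (K : R) :
  (forall n m, (n <= m)%N -> `|u m - u n| <= T m - T n) ->
  (forall n, T n <= K) -> cvgn u.
Proof.
move=> uT TK.
have Tnd : {homo T : n m / (n <= m)%N >-> n <= m}.
  by move=> n m /uT /(le_trans (normr_ge0 _)); rewrite subr_ge0.
have [t Tt Tle] := nondecreasing_bounded_cvg Tnd TK.
have [s us _] : exists2 s : R, (u \+ T) @ \oo --> s & forall n, (u \+ T) n <= s.
  apply: (@nondecreasing_bounded_cvg _ _ (u 0%N + (K - T 0%N) + K)) => [n m nm|n].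
    by have := uT _ _ nm; rewrite ler_norml /= => /andP[? _]; lra.
  have := uT 0%N n isT; rewrite ler_norml /= => /andP[_ ?].
  by have := TK n; lra.
have -> : u = (u \+ T) \- T by apply/funext => n /=; ring.
by apply/cvg_ex; exists (s - t); exact: cvgB.
Qed.

Lemma norm_real_complex (R : realType) (x : R) : `|x%:C| = `|x|%:C.
Proof. by rewrite normc_def /= expr0n/= addr0 sqrtr_sqr. Qed.

Lemma norm_complex_i (R : realType) : `| 'i%C : R[i] | = 1.
Proof. by rewrite normc_def /= expr0n/= expr1n add0r sqrtr1. Qed.

Lemma norm_ge_Im (R : realType) (x : R[i]) : `|complex.Im x|%:C <= `|x|.
Proof.
have := normc_ge_Re (x * 'i); rewrite ReiNIm normrN normrM.
by rewrite norm_complex_i mulr1.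
Qed.

Lemma complex_dominated_cvg (R : realType) (T : nat -> R) (u : nat -> R[i]^o) (K : R) :
  (forall n m, (n <= m)%N -> `|u m - u n| <= ((T m - T n)%:C : R[i])) ->
  (forall n, T n <= K) -> exists L : R[i]^o, u @ \oo --> L.
Proof.
move=> uT TK.
have /cvg_ex[a ua] : cvgn (fun n => complex.Re (u n)).
  apply: (@dominated_cvg _ T _ K) => // n m nm.
  rewrite -lecR; apply: le_trans (uT _ _ nm); rewrite -raddfB.
  exact: normc_ge_Re.
have /cvg_ex[b ub] : cvgn (fun n => complex.Im (u n)).
  apply: (@dominated_cvg _ T _ K) => // n m nm.
  rewrite -lecR; apply: le_trans (uT _ _ nm); rewrite -raddfB.
  exact: norm_ge_Im.
exists (a +i* b); apply/complex_cvgP => e e0.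
near=> n.
have na : `|a - complex.Re (u n)| <= e / 2.
  by near: n; apply: cvgr_dist_le => //; rewrite divr_gt0.
have nb : `|b - complex.Im (u n)| <= e / 2.
  by near: n; apply: cvgr_dist_le => //; rewrite divr_gt0.
have -> : a +i* b - u n = (a - complex.Re (u n))%:C + 'i * (b - complex.Im (u n))%:C.
  by rewrite [LHS]complexE; case: (u n).
apply: le_trans (ler_normD _ _) _; rewrite normrM.
rewrite norm_complex_i mul1r !norm_real_complex -rmorphD lecR.
by rewrite (le_trans (lerD na nb))// -splitr.
Unshelve. all: by end_near. Qed.

Lemma real_complex_cvg (R : realType) (u : nat -> R) (l : R) :
  u @ \oo --> l -> (fun n => (u n)%:C : R[i]^o) @ \oo --> (l%:C : R[i]^o).
Proof.
move=> ul; apply/complex_cvgP => e e0; near=> n.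
rewrite -rmorphB norm_real_complex lecR.
by near: n; exact: cvgr_dist_le.
Unshelve. all: by end_near. Qed.

(** Transports a sum over an explicit list to a sum over a finite set of the
    index type I, seen inside T through v. *)
Lemma fset_of_seq (I : choiceType) (T : eqType) (v : I -> T) (l : seq T) :
  injective v -> uniq l -> (forall t, t \in l -> exists i, v i = t) ->
  exists A : {fset I}, (forall i, (i \in A) = (v i \in l)) /\
    forall (V : nmodType) (f : T -> V), \sum_(i <- A) f (v i) = \sum_(t <- l) f t.
Proof.
move=> vI; elim: l => [|t l IH] /=.
  by exists fset0; split=> [i|V f]; rewrite ?inE// big_seq_fset0 big_nil.
move=> /andP[tl ul] lv.
have [|A [Al sA]] := IH ul; first by move=> s sl; apply: lv; rewrite inE sl orbT.
have [i vi] := lv t (mem_head _ _).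
have iA : i \notin A by rewrite Al vi.
exists (i |` A)%fset; split=> [j|V f].
  by rewrite in_fset1U inE Al -vi (inj_eq vI).
by rewrite big_fsetU1//= big_cons sA vi.
Qed.

Lemma fset_sub_exhaust (I : choiceType) (A : nat -> {fset I}) (B : seq I) :
  (forall n m, (n <= m)%N -> {subset A n <= A m}) ->
  (forall i, exists n, i \in A n) -> exists n, {subset B <= A n}.
Proof.
move=> Amon Aex; elim: B => [|i B [n Bn]]; first by exists 0%N.
have [m im] := Aex i; exists (maxn n m) => j; rewrite inE => /predU1P[->|/Bn].
  exact: Amon (leq_maxr _ _) _ im.
exact: Amon (leq_maxl _ _) _.
Qed.

Lemma sum_fset_sub (I : choiceType) (V : zmodType) (A B : {fset I}) (f : I -> V) :
  {subset A <= B} ->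
  \sum_(i <- B) f i = \sum_(i <- A) f i + \sum_(i <- (B `\` A)%fset) f i.
Proof.
move=> AB; rewrite (big_fsetID _ (mem A))/=; congr (_ + _).
  apply: eq_fbigl => i; rewrite !inE/=.
  by apply/andb_idl; exact: AB.
by apply: eq_fbigl => i; rewrite !inE/= andbC.
Qed.

Lemma partial_sumE (I : choiceType) (V : zmodType) (x : I -> V) (B : {fset I}) :
  partial_sum x B = \sum_(i <- B) x i.
Proof. by rewrite big_seq_fsetE. Qed.

(** A family dominated by a summable one may be summed along any exhausting
    sequence of finite sets: once A n captures most of the sum of g, a larger
    finite set changes the sum of x by little. *)
Lemma partial_sum_cvg (R : realType) (I : choiceType) (A : nat -> {fset I})
    (x : I -> R[i]^o) (g : I -> R) (K : R) (L : R[i]^o) :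
  (forall n m, (n <= m)%N -> {subset A n <= A m}) ->
  (forall i, exists n, i \in A n) ->
  (forall i, `|x i| <= ((g i)%:C : R[i])) ->
  (forall n, \sum_(i <- A n) g i <= K) ->
  (fun n => \sum_(i <- A n) x i) @ \oo --> L ->
  partial_sum x @ totally --> L.
Proof.
move=> Amon Aex xg gK xL.
have g0 i : 0 <= g i by rewrite -ler0c (le_trans (normr_ge0 _) (xg i)).
pose T n := \sum_(i <- A n) g i.
have Tnd : {homo T : n m / (n <= m)%N >-> n <= m}.
  move=> n m nm; rewrite /T (sum_fset_sub _ (Amon _ _ nm)) lerDl.
  by rewrite sumr_ge0.
have [t Tt Tle] := nondecreasing_bounded_cvg Tnd gK.
have totallyF : ProperFilter (@totally I) := totally_filter.
apply/complex_cvgP => e e0.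
have e2 : 0 < e / 2 by rewrite divr_gt0.
have [n []] : exists n, `|L - \sum_(i <- A n) x i| <= ((e / 2)%:C : R[i])
    /\ `|t - T n| <= e / 2.
  have /filter_ex[n ?] : \forall n \near \oo,
      `|L - \sum_(i <- A n) x i| <= ((e / 2)%:C : R[i]) /\ `|t - T n| <= e / 2.
    near=> n; split; near: n.
      by move/complex_cvgP: xL; apply.
    exact: cvgr_dist_le.
  by exists n.
move=> Ln Tn; exists (A n) => // B /= /fsubsetP AB.
rewrite partial_sumE (sum_fset_sub _ AB) opprD addrA.
apply: le_trans (ler_normB _ _) _.
rewrite [e]splitr rmorphD lerD//.
apply: le_trans (ler_norm_sum _ _ _) _.
apply: (@le_trans _ _ (\sum_(i <- (B `\` A n)%fset) (g i)%:C)).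
  by apply: ler_sum => i _; exact: xg.
rewrite -rmorph_sum lecR.
apply: le_trans Tn; rewrite ger0_norm ?subr_ge0//.
have [m Bm] := fset_sub_exhaust B Amon Aex.
rewrite lerBrDl -sum_fset_sub//; apply: le_trans (Tle m).
by rewrite /T (sum_fset_sub _ Bm) lerDl sumr_ge0.
Unshelve. all: by end_near. Qed.

Lemma cvg_sum_seq (K : numFieldType) (V : normedModType K) (T : eqType) (s : seq T)
    (u : T -> nat -> V) (l : T -> V) :
  (forall t, t \in s -> u t @ \oo --> l t) ->
  (fun n => \sum_(t <- s) u t n) @ \oo --> \sum_(t <- s) l t.
Proof.
elim: s => [|t s IH] us.
  have -> : (fun n => \sum_(t <- [::]) u t n) = fun=> 0 :> V.
    by apply/funext => n; rewrite big_nil.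
  by rewrite big_nil; exact: cvg_cst.
have -> : (fun n => \sum_(j <- t :: s) u j n) = u t \+ (fun n => \sum_(j <- s) u j n).
  by apply/funext => n; rewrite big_cons.
rewrite big_cons; apply: cvgD; first by apply: us; rewrite mem_head.
by apply: IH => j js; apply: us; rewrite inE js orbT.
Qed.

Lemma partial_sum_is_cvg (R : realType) (I : choiceType) (A : nat -> {fset I})
    (x : I -> R[i]^o) (g : I -> R) (K : R) :
  (forall n m, (n <= m)%N -> {subset A n <= A m}) ->
  (forall i, `|x i| <= ((g i)%:C : R[i])) ->
  (forall n, \sum_(i <- A n) g i <= K) ->
  exists L : R[i]^o, (fun n => \sum_(i <- A n) x i) @ \oo --> L.
Proof.
move=> Amon xg gK.
apply: (@complex_dominated_cvg _ (fun n => \sum_(i <- A n) g i) _ K) => // n m nm.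
rewrite !(sum_fset_sub _ (Amon _ _ nm)) !(addrC (\sum_(i <- A n) _)) !addrK.
rewrite rmorph_sum; apply: le_trans (ler_norm_sum _ _ _) _.
by apply: ler_sum => i _; exact: xg.
Qed.

Lemma chains_mono m n n' s : (n <= n')%N -> s \in chains m n -> s \in chains m n'.
Proof.
rewrite !mem_chains => nn' /and3P[-> ps ->]; rewrite andbT/=.
by case: s ps => //= k s /andP[kn ->]; rewrite andbT (leq_trans kn).
Qed.

(** Chains with k_0 <= n exhaust the index type of the right-hand side. *)
Lemma chain_fsets m : exists A : nat -> {fset chain m},
  [/\ forall n n', (n <= n')%N -> {subset A n <= A n'},
      forall k, exists n, k \in A n &
      forall (V : nmodType) (f : seq nat -> V) n,
        \sum_(k <- A n) f (val (val k)) = \sum_(s <- chains m n) f s].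
Proof.
pose v (k : chain m) : seq nat := val (val k).
have vI : injective v by move=> k k' /val_inj/val_inj.
have /choice[A AE] : forall n, exists A : {fset chain m},
    (forall i, (i \in A) = (v i \in chains m n)) /\
    forall (V : nmodType) (f : seq nat -> V),
      \sum_(i <- A) f (v i) = \sum_(t <- chains m n) f t.
  move=> n; apply: fset_of_seq => // [|s]; first exact: chains_uniq.
  rewrite mem_chains => /and3P[sm ps s1].
  have sP : sorted geq (Tuple sm) && all (leq 1) (Tuple sm).
    by rewrite s1 andbT; exact: path_sorted ps.
  by exists (exist _ (Tuple sm) sP).
exists A; split=> [n n' nn' k|k|V f n]; last exact: (AE n).2.
  by rewrite !(AE _).1; exact: chains_mono.
exists (head 0%N (v k)); rewrite (AE _).1 mem_chains.
rewrite /v; case: k => /= k /andP[sk ->]; rewrite size_tuple eqxx andbT.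
by case: (val k) sk => //= j s js; rewrite leqnn.
Qed.

(** Tuples with sum < n exhaust the index type of the left-hand side. *)
Lemma tuples_below_fsets m : exists A : nat -> {fset m.-tuple nat},
  [/\ forall n n', (n <= n')%N -> {subset A n <= A n'},
      forall k, exists n, k \in A n &
      forall (V : nmodType) (f : seq nat -> V) n,
        \sum_(a <- A n) f (val a) = \sum_(s <- tuples_below m n) f s].
Proof.
have /choice[A AE] : forall n, exists A : {fset m.-tuple nat},
    (forall i, (i \in A) = (val i \in tuples_below m n)) /\
    forall (V : nmodType) (f : seq nat -> V),
      \sum_(i <- A) f (val i) = \sum_(t <- tuples_below m n) f t.
  move=> n; apply: fset_of_seq => // [|s]; first exact: tuples_below_uniq.
  by rewrite mem_tuples_below => /andP[sm _]; exists (Tuple sm).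
exists A; split=> [n n' nn' k|k|V f n]; last exact: (AE n).2.
  by rewrite !(AE _).1 !mem_tuples_below => /andP[-> /leq_trans->].
by exists (sumn k).+1; rewrite (AE _).1 mem_tuples_below size_tuple eqxx ltnSn.
Qed.

Lemma zeta_part_nest (F : fieldType) s p n :
  nest [seq (fun _ k : nat => k%:R ^- e) | e <- s] p n = zeta_part F s n.
Proof.
elim: s p n => [|e s IH] p n //.
by rewrite /zeta_part -/zeta_part /=; apply: eq_bigr => k _; rewrite IH.
Qed.

(** Boundedness makes the extended sum finite, so that [fine] does not send it
    to 0. *)
Lemma zeta_star_cvg (R : realType) (s : seq nat) (K : R) :
  (forall n, zeta_part R s n <= K) ->
  zeta_part R s @ \oo --> zeta_star R s
  /\ forall n, zeta_part R s n <= zeta_star R s.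
Proof.
move=> zK.
pose w : seq nat -> R := chain_prod [seq (fun _ k : nat => k%:R ^- e) | e <- s] 0.
have [A [Amon Aex sA]] := chain_fsets (size s).
have wE (k : chain (size s)) :
    \prod_(i < size s) (tnth (val k) i)%:R ^- nth 0%N s i = w (val (val k)).
  rewrite /w chain_prod_nth ?size_tuple ?size_map//.
  apply: eq_bigr => i _.
  by rewrite (nth_map 0%N)// (tnth_nth 0%N).
have w0 (k : chain (size s)) : 0 <= w (val (val k)).
  by rewrite -wE prodr_ge0// => i _; rewrite invr_ge0 exprn_ge0.
have zA n : zeta_part R s n = \sum_(k <- A n) w (val (val k)).
  rewrite sA -(zeta_part_nest _ _ 0%N) -sum_chains size_map.
  by [].
have znd : {homo zeta_part R s : n m / (n <= m)%N >-> n <= m}.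
  move=> n m nm; rewrite !zA (sum_fset_sub _ (Amon _ _ nm)) lerDl.
  by rewrite sumr_ge0.
have [t zt tle] := nondecreasing_bounded_cvg znd zK.
suff -> : zeta_star R s = t by [].
rewrite /zeta_star.
suff -> : (\esum_(k in [set: chain (size s)])
    (\prod_(i < size s) (tnth (val k) i)%:R ^- nth 0%N s i)%:E = t%:E)%E by [].
apply/eqP; rewrite eq_le; apply/andP; split.
  apply: ge_ereal_sup => _ [X [/finite_fsetP[B ->] _] <-].
  rewrite fsbig_finite ?set_fsetK// sumEFin lee_fin.
  have [n Bn] := fset_sub_exhaust B Amon Aex.
  apply: le_trans (tle n); rewrite zA (sum_fset_sub _ Bn).
  rewrite (eq_bigr _ (fun i _ => wE i)) lerDl.
  by rewrite sumr_ge0.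
set E := (\esum_(_ in _) _)%E.
have zE n : ((zeta_part R s n)%:E <= E)%E.
  apply: esum_ge; exists [set` A n]; first by split.
  by rewrite fsbig_finite ?set_fsetK// sumEFin lee_fin zA (eq_bigr _ (fun i _ => wE i)).
case: E zE => [r||] zE; rewrite ?leey//; last by have := zE 0%N.
rewrite lee_fin; apply: (cvgr_to_le zt).
by near=> n; exact: zE.
Unshelve. all: by end_near. Qed.

(** The sum over k > M is small by summability of g, uniformly in n; for k <=
    M the weights are at most M^2/n. *)
Lemma cvg_sum_one_sub_cbin (R : realType) (g : nat -> R) (K : R) :
  (forall k, 0 <= g k) -> (forall n, \sum_(1 <= k < n.+1) g k <= K) ->
  (fun n => \sum_(1 <= k < n.+1) (1 - cbin R n k) * g k) @ \oo --> 0.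
Proof.
move=> g0 gK; pose G n := \sum_(1 <= k < n.+1) g k.
have Gnd : {homo G : n m / (n <= m)%N >-> n <= m}.
  move=> n m nm; rewrite /G (@big_cat_nat _ _ _ n.+1 1 m.+1)//= lerDl.
  by rewrite sumr_ge0.
have [t Gt tle] := nondecreasing_bounded_cvg Gnd gK.
have b0 n k : 0 <= 1 - cbin R n k by rewrite subr_ge0 cbin_le1.
apply/cvgrPdist_le => e e0.
have e2 : 0 < e / 2 by rewrite divr_gt0.
have [M GM] : exists M, `|t - G M| <= e / 2.
  have /filter_ex[M ?] : \forall n \near \oo, `|t - G n| <= e / 2.
    exact: cvgr_dist_le.
  by exists M.
near=> n.
have Mn : (M <= n)%N by near: n; exact: nbhs_infty_ge.
have n0 : (0 < n)%N by near: n; exact: nbhs_infty_gt.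
have nb : M%:R ^+ 2 * t / (e / 2) <= n%:R by near: n; exact: nbhs_infty_ger.
rewrite sub0r normrN ger0_norm; last first.
  by rewrite sumr_ge0// => k _; rewrite mulr_ge0.
rewrite (@big_cat_nat _ _ _ M.+1 1 n.+1)//= [e]splitr lerD//; last first.
  apply: (@le_trans _ _ (\sum_(M.+1 <= k < n.+1) g k)).
    by apply: ler_sum => k _; rewrite ler_piMl// lerBlDr lerDl cbin_ge0.
  apply: le_trans GM; rewrite ger0_norm ?subr_ge0// lerBrDl.
  by apply: le_trans (tle n); rewrite [leRHS](@big_cat_nat _ _ _ M.+1).
apply: (@le_trans _ _ (M%:R ^+ 2 / n%:R * G M)).
  rewrite mulr_sumr; apply: ler_sum_nat => k /andP[k0 kM].
  rewrite ler_wpM2r// (le_trans (one_sub_cbin_le _ _ n0))//.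
  by rewrite ler_wpM2r ?invr_ge0// lerXn2r ?nnegrE// ler_nat.
rewrite mulrAC ler_pdivrMr ?ltr0n//.
move: nb; rewrite ler_pdivrMr// [leRHS]mulrC; apply: le_trans.
by rewrite ler_wpM2l ?exprn_ge0.
Unshelve. all: by end_near. Qed.

(** * Compatibility with embeddings of fields *)

Lemma rmorph_cbin (K F : fieldType) (i : {rmorphism K -> F}) n k :
  i (cbin K n k) = cbin F n k.
Proof.
elim: k => [|k IH] /=; first by rewrite rmorph1.
by rewrite !rmorphM fmorphV !rmorph_nat IH.
Qed.

Lemma rmorph_zeta_part (K F : fieldType) (i : {rmorphism K -> F}) s n :
  i (zeta_part K s n) = zeta_part F s n.
Proof.
elim: s n => [|e s IH] n; first by rewrite rmorph1.
rewrite /zeta_part -!/zeta_part rmorph_sum; apply: eq_bigr => k _.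
by rewrite rmorphM fmorphV rmorphXn rmorph_nat IH.
Qed.

Lemma rmorph_gen_trunc (K F : fieldType) (i : {rmorphism K -> F})
    (l : seq (nat * K)) z n :
  i (gen_trunc l z n) = gen_trunc [seq (p.1, i p.2) | p <- l] (i z) n.
Proof.
elim: l z n => [|[c y] l IH] z; elim=> [|n IHn]; rewrite ?gen_trunc0 ?rmorph_nat//.
  by rewrite !gen_truncS rmorphM fmorphV rmorphB rmorphM fmorphV !rmorphXn rmorph_nat
     rmorph1 rmorphD rmorph0 IHn.
rewrite map_cons gen_truncS [RHS]gen_truncS rmorphM fmorphV rmorphB rmorphM.
rewrite fmorphV !rmorphXn rmorph_nat.
by rewrite rmorph1 rmorphD IHn rmorphM fmorphV rmorphXn rmorph_nat IH.
Qed.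

Lemma off_squares_lt1 (F : numFieldType) (z : F) : `|z| < 1 -> off_squares z.
Proof.
move=> z1 k k0; rewrite subr_eq0; apply/eqP => kz.
have : `|z| ^+ 2 < 1 by rewrite expr_lt1.
by rewrite -normrX -kz normrX normr_nat expr_lt1// ltrn1; case: k k0 {kz}.
Qed.

Lemma monomial_le (K F : numFieldType) (i : {rmorphism K -> F}) (r : K)
    (zs : seq F) (a : seq nat) :
  all (fun y => `|y| <= i r) zs ->
  `|monomial zs a| <= i (monomial (nseq (size zs) r) a).
Proof.
rewrite /monomial; elim: zs a => [|y zs IH] [|k a] /=;
  rewrite ?big_nil ?normr1 ?rmorph1//.
move=> /andP[yr lr]; rewrite !big_cons/= normrM rmorphM ler_pM ?IH//.
by rewrite normrX rmorphXn lerXn2r ?nnegrE// (le_trans _ yr).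
Qed.

(** The closed form is used here to bound the generating function itself:
    B(n,k) lies between 0 and 1, so the absolute bound on the chain products
    applies. *)
Lemma gen_trunc_bounded (R : realFieldType) (r : R) y (l : seq (nat * R)) :
  0 <= r < 1 -> all (mem [:: 1; 3]%N) (unzip1 l) ->
  all (pred1 r) (unzip2 ((3%N, y) :: l)) ->
  exists K : R, forall n, gen_trunc ((3%N, y) :: l) r n <= K.
Proof.
move=> /andP[r0 r1] l13 lr.
have C0 : 0 <= 2 / (1 - r ^+ 2).
  by rewrite divr_ge0// subr_ge0 exprn_ile1// ltW.
have [K HK] := @nest_bound_bounded R R _ r y l C0 l13.
exists K => n; rewrite gen_truncE//; first last.
- move=> w /(allP lr)/= /eqP ->; apply: off_squares_lt1; rewrite ger0_norm//.
- by apply: off_squares_lt1; rewrite ger0_norm.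
apply: le_trans (ler_norm _) _; rewrite normrN; apply: le_trans (HK n).
apply: le_trans (ler_norm_sum _ _ _) _; rewrite [nest _ _ _]/=.
apply: ler_sum_nat => k /andP[k0 _].
have lr' : all (fun w => `|w| <= r) (unzip2 ((3%N, y) :: l)).
  by apply: sub_all lr => w /eqP ->; rewrite ger0_norm.
rewrite normrM ger0_norm ?cbin_ge0// -[leRHS]mul1r ler_pM ?cbin_ge0 ?cbin_le1//.
rewrite /row_term normrM ler_pM//.
  by apply: weight_le; rewrite ?ger0_norm.
exact: (@nest_le _ _ idfun r ((3%N, y) :: l)).
Qed.

(** * Both sides as limits *)

Lemma sum_cvgE (R : realType) (I : choiceType) (x : I -> R[i]^o) (L : R[i]^o) :
  partial_sum x @ totally --> L ->
  cvg (partial_sum x @ totally) /\ sum x = L.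
Proof.
move=> xL; have totallyF : ProperFilter (@totally I) := totally_filter.
split; first by apply/cvg_ex; exists L.
by apply: cvg_lim xL; exact: norm_hausdorff.
Qed.

(** The chain products are absolutely summable, and the closed form of the
    generating function differs from minus their sum over k_0 <= n only
    through the weights 1 - B(n,k). *)
Lemma chain_sum_cvg (R : realType) (m : nat) (r : R) (z : R[i]) y
    (l : seq (nat * R[i])) :
  size l = m ->
  0 <= r < 1 -> all (mem [:: 1; 3]%N) (unzip1 l) ->
  all (fun w => `|w| <= r%:C) (z :: unzip2 ((3%N, y) :: l)) ->
  exists L : R[i]^o,
  (partial_sum ((fun k : chain m.+2 =>
      chain_prod (weights (@weight R[i]) [:: (1%N, z), (3%N, y) & l]) 0 (val (val k)))
       : _ -> R[i]^o)
     @ totally --> L) /\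
  (fun n => gen_trunc ((3%N, y) :: l) z n : R[i]^o) @ \oo --> - L.
Proof.
move=> <- /andP[r0 r1] l13 lr.
pose C : R := 2 / (1 - r ^+ 2).
have C0 : 0 <= C by rewrite divr_ge0// subr_ge0 exprn_ile1// ltW.
have ir1 : real_complex R r < 1 by rewrite -[1]/(1%:C) ltcR.
pose l' := [:: (1%N, z), (3%N, y) & l].
have [K HK] := @nest_bound_bounded R R[i] C z y l C0 l13.
have [A [Amon Aex sA]] := chain_fsets (size l).+2.
have szw : size (weights (@weight R[i]) l') = (size l).+2.
  by rewrite size_weights.
have szb : size (weights (@weight_bound R R[i] C) l') = (size l).+2.
  by rewrite size_weights.
pose x (k : chain (size l).+2) : R[i]^o :=
  chain_prod (weights (@weight R[i]) l') 0 (val (val k)).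
pose g (k : chain (size l).+2) : R :=
  chain_prod (weights (@weight_bound R R[i] C) l') 0 (val (val k)).
have xg k : `|x k| <= ((g k)%:C : R[i]).
  apply: (@chain_prod_le R R[i] (real_complex R)) => //.
  by case: (k) => /= k' /andP[].
have gK n : \sum_(k <- A n) g k <= K.
  rewrite (sA _ (chain_prod (weights (@weight_bound R R[i] C) l') 0)).
  by rewrite -{1}szb sum_chains.
have [L xL] := partial_sum_is_cvg Amon xg gK.
exists L; split; first exact: partial_sum_cvg Amon Aex xg gK xL.
pose row k := row_term ((3%N, y) :: l) z k.
have xrow n : \sum_(k <- A n) x k = \sum_(1 <= k < n.+1) row k.
  rewrite (sA _ (chain_prod (weights (@weight R[i]) l') 0)).
  by rewrite -{1}szw sum_chains.
pose h k : R := weight_bound C 1 z 0 k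
  * nest (weights (@weight_bound R R[i] C) ((3%N, y) :: l)) k k.
have h0 k : 0 <= h k.
  apply: mulr_ge0; last exact: nest_bound_ge0.
  by apply: divr_ge0; rewrite ?exprn_ge0//; apply: mulr_ge0; rewrite ?exprn_ge0.
have rowh k : (0 < k)%N -> `|row k| <= (h k)%:C.
  move=> k0; rewrite /row /row_term normrM /h rmorphM ler_pM//.
    apply: (@weight_le_morph R R[i] (real_complex R) r _ z 1%N) => //.
    by case/andP: lr.
  by apply: (@nest_le R R[i] (real_complex R)) => //; case/andP: lr.
have hT := @cvg_sum_one_sub_cbin R h K h0 HK.
have lt1 w : `|w| <= r%:C -> off_squares w.
  by move=> wr; apply: off_squares_lt1; apply: le_lt_trans wr ir1.
have genE n : gen_trunc ((3%N, y) :: l) z n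
   = - (\sum_(k <- A n) x k) + \sum_(1 <= k < n.+1) (1 - cbin R[i] n k) * row k.
  rewrite gen_truncE//; first last.
  - by move=> w wl; apply: lt1; apply: (allP lr); rewrite inE wl orbT.
  - by apply: lt1; case/andP: lr.
  rewrite xrow -!sumrN -big_split/=; apply: eq_bigr => k _.
  by rewrite /row; ring.
have -> : (fun n => gen_trunc ((3%N, y) :: l) z n : R[i]^o) =
   (fun n => - (\sum_(k <- A n) x k)) \+
   (fun n => \sum_(1 <= k < n.+1) (1 - cbin R[i] n k) * row k : R[i]^o).
  by apply/funext => n; exact: genE.
rewrite -[- L]addr0; apply: cvgD; first exact: cvgN.
apply/complex_cvgP => e e0; move/cvgrPdist_le: hT => /(_ _ e0); apply: filterS => n.
rewrite !sub0r !normrN => hn.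
apply: (@le_trans _ _ (`|\sum_(1 <= k < n.+1) (1 - cbin R n k) * h k|%:C)); last first.
  by rewrite lecR.
have b0 k : 0 <= 1 - cbin R n k by rewrite subr_ge0 cbin_le1.
rewrite [X in _ <= X%:C]ger0_norm; last first.
  by apply: sumr_ge0 => k _; exact: mulr_ge0 (b0 _) (h0 _).
rewrite rmorph_sum; apply: le_trans (ler_norm_sum _ _ _) _.
apply: ler_sum_nat => k /andP[k0 _].
rewrite normrM rmorphM ler_pM ?rowh//.
rewrite -(rmorph_cbin (real_complex R)) -[1]/(1%:C) -rmorphB.
by rewrite norm_real_complex ger0_norm.
Qed.

(** With r^2 bounding the variables, r is a larger radius at which the
    generating function is still bounded. This bounds the truncated zeta-star
    values, dominates the family, and makes the error of truncating by degree
    at most (r^2)^N K uniformly in n; so the limit of the generating functions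
    is the sum of the limits. *)
Lemma zeta_sum_cvg (R : realType) (m : nat) (r : R) (z : R[i]) y
    (l : seq (nat * R[i])) (L : R[i]^o) :
  size l = m ->
  0 < r < 1 -> all (mem [:: 1; 3]%N) (unzip1 l) ->
  all (fun w => `|w| <= (r ^+ 2)%:C) (z :: unzip2 ((3%N, y) :: l)) ->
  (fun n => gen_trunc ((3%N, y) :: l) z n : R[i]^o) @ \oo --> L ->
  partial_sum ((fun a : m.+2.-tuple nat =>
      (zeta_star R (insert_twos (3%N :: unzip1 l) a))%:C *
      monomial [:: z, y & unzip2 l] a) : _ -> R[i]^o)
     @ totally --> L.
Proof.
move=> <- /andP[r0 r1] l13 lr genL.
have r01 : 0 <= r < 1 by rewrite ltW.
set l' := (3%N, y) :: l; pose lR : seq (nat * R) := [seq (p.1, r) | p <- l'].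
have u1 : unzip1 lR = 3%N :: unzip1 l.
  by rewrite /lR /unzip1 -map_comp; apply: eq_map.
have u2 : unzip2 lR = nseq (size l).+1 r.
  by rewrite /lR /unzip2 -map_comp/=; congr cons; elim: (l) => //= a l1 ->.
have [K HK] : exists K, forall n, gen_trunc lR r n <= K.
  apply: gen_trunc_bounded => //.
    by move: u1; rewrite /lR /= => -[->].
  by move: u2; rewrite /lR /= => -[->]; rewrite eqxx all_nseq/= eqxx orbT.
have szlR : size lR = (size l).+1 by rewrite size_map.
pose rs := nseq (size l).+2 r.
pose zp := fun a n => zeta_part R (insert_twos (3%N :: unzip1 l) a) n.
have zp0 a n : 0 <= zp a n.
  rewrite /zp; elim: (insert_twos _ _) n => [|e s IH] n //.
  rewrite /zeta_part -/zeta_part sumr_ge0// => k _.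
  by rewrite mulr_ge0// invr_ge0 exprn_ge0.
have mon0 a : size a = (size l).+2 -> 0 < monomial rs a.
  rewrite /rs /monomial; elim: ((size l).+2) a => [|q IH] [|k a]//=.
    by rewrite big_nil.
  by move=> [sa]; rewrite big_cons mulr_gt0 ?exprn_gt0 ?IH.
(* By the bound with th = 1, the part of degree < N differs from the
   generating function by at most the latter, whence the factor 2. *)
have partK n N : \sum_(a <- tuples_below (size l).+2 N) zp a n * monomial rs a <= 2 * K.
  have := @gen_deg_error R lR r 1 r n N; rewrite expr1n !mul1r.
  have -> : [seq (p.1, r) | p <- lR] = lR by rewrite /lR -map_comp.
  move=> /(_ _ r01) H.
  have {H} : `|gen_trunc lR r n - gen_deg lR r n N| <= gen_trunc lR r n.
    apply: H; rewrite ?lexx ?ler01// ?u2 ?all_nseq ger0_norm ?lexx ?orbT//; exact/ltW.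
  rewrite /gen_deg u1 u2 szlR -/rs => H.
  have := HK n; move: H; rewrite ler_norml => /andP[H _].
  by rewrite -/(zp _ n) in H *; lra.
pose cs := 3%N :: unzip1 l.
have K0 : 0 <= 2 * K.
  by apply: le_trans (partK 0%N 0%N); rewrite big_nil.
have termK (a : (size l).+2.-tuple nat) n : zp a n * monomial rs a <= 2 * K.
  apply: le_trans (partK n (sumn a).+1).
  rewrite (bigD1_seq (val a)) ?tuples_below_uniq//=; last first.
    by rewrite mem_tuples_below size_tuple eqxx ltnSn.
  rewrite lerDl big_seq_cond sumr_ge0// => b.
  rewrite mem_tuples_below => /andP[/andP[/eqP sb _] _].
  by rewrite mulr_ge0// ltW// mon0.
have zcvg a : size a = (size l).+2 ->
    (zp a : nat -> R) @ \oo --> zeta_star R (insert_twos cs a)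
    /\ forall n, zp a n <= zeta_star R (insert_twos cs a).
  move=> sa; apply: (@zeta_star_cvg _ _ (2 * K / monomial rs a)) => n.
  rewrite ler_pdivlMr ?mon0//.
  by have := termK (Tuple (introT eqP sa)) n.
pose zs := [:: z, y & unzip2 l].
pose f a : R[i] := (zeta_star R (insert_twos cs a))%:C * monomial zs a.
pose g a : R := zeta_star R (insert_twos cs a) * monomial rs a.
have szs : size zs = (size l).+2 by rewrite /= size_map.
have ir2 : r ^+ 2 <= r by rewrite expr2 ler_piMl// ltW.
have fg (a : (size l).+2.-tuple nat) : `|f a| <= (g a)%:C.
  rewrite /f normrM /g rmorphM ler_pM//.
    rewrite norm_real_complex ger0_norm//.
    by have [_ /(_ 0%N)] := zcvg _ (size_tuple a); apply: le_trans.
  have -> : rs = nseq (size zs) r by rewrite szs.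
  apply: (@monomial_le R R[i] (real_complex R)).
  apply: sub_all lr => w /le_trans; apply.
  by rewrite lecR.
have gK N : \sum_(a <- tuples_below (size l).+2 N) g a <= 2 * K.
  apply: (@cvgr_to_le _ \oo _ _
    (fun n => \sum_(a <- tuples_below (size l).+2 N) zp a n * monomial rs a)).
    apply: cvg_sum_seq => a; rewrite mem_tuples_below => /andP[/eqP sa _].
    by apply: cvgMr_tmp; exact: (zcvg a sa).1.
  by near=> n; exact: partK.
have [A [Amon Aex sA]] := tuples_below_fsets (size l).+2.
apply: (@partial_sum_cvg R _ A _ (fun a => g a) (2 * K)) => // [n|].
  by rewrite (sA _ g).
have -> : (fun n => \sum_(a <- A n)
      ((zeta_star R (insert_twos (3%N :: unzip1 l) a))%:C
         * monomial [:: z, y & unzip2 l] a : R[i]^o))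
    = (fun n => \sum_(a <- tuples_below (size l).+2 n) f a : R[i]^o).
  by apply/funext => n; rewrite (sA _ f).
have fcvg N : (fun n => gen_deg l' z n N : R[i]^o) @ \oo -->
   (\sum_(a <- tuples_below (size l).+2 N) f a : R[i]^o).
  rewrite /gen_deg; apply: cvg_sum_seq => a.
  rewrite mem_tuples_below => /andP[/eqP sa _].
  apply: cvgMr_tmp.
  apply: cvg_trans (real_complex_cvg (zcvg a sa).1); apply: near_eq_cvg.
  by near=> n; rewrite -(rmorph_zeta_part (real_complex R)).
have sq_le (w : R[i]) : `|w| <= (r ^+ 2)%:C -> `|w| ^+ 2 <= (r ^+ 2)%:C * r%:C ^+ 2.
  move=> wr; rewrite -[r%:C ^+ 2]rmorphXn -expr2 lerXn2r ?nnegrE//.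
  exact: le_trans wr.
(* Here th = r^2, as the squared moduli are at most r^4 = th r^2. *)
have majo n N : `|gen_trunc l' z n - gen_deg l' z n N| <= ((r ^+ 2) ^+ N * K)%:C.
  have := @gen_deg_error R[i] l' z (r ^+ 2)%:C r%:C n N.
  have -> : [seq (p.1, r%:C) | p <- l'] = [seq (p.1, p.2%:C) | p <- lR].
    by rewrite /lR -map_comp.
  rewrite -(rmorph_gen_trunc (real_complex R)) => H.
  apply: (@le_trans _ _ (((r ^+ 2) ^+ N * gen_trunc lR r n)%:C)); last first.
    by rewrite lecR ler_wpM2l// !exprn_ge0// ltW.
  rewrite rmorphM rmorphXn; apply: H.
  - by rewrite ler0c (lecR _ 1) exprn_ge0 ?exprn_ile1 ?ltW.
  - by rewrite ler0c (ltcR _ 1) ltW.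
  - by apply: sq_le; case/andP: lr.
  - by apply/allP => w wl; apply: sq_le; apply: (allP lr); rewrite inE wl orbT.
apply/complex_cvgP => e e0.
have e3 : 0 < e / 3 by rewrite divr_gt0.
have rN : (fun N => (r ^+ 2) ^+ N * K) @ \oo --> 0.
  rewrite -[0](mul0r K); apply: cvgMr_tmp; apply: cvg_expr.
  by rewrite ger0_norm ?exprn_ge0 ?exprn_ilt1// ltW.
near=> N.
have rNe : (r ^+ 2) ^+ N * K <= e / 3.
  near: N.
  move/cvgrPdist_le: rN => /(_ _ e3); apply: filterS => N.
  by rewrite sub0r normrN; apply: le_trans; exact: ler_norm.
have /filter_ex[n [n1 n2]] : \forall n \near \oo,
    `|L - gen_trunc l' z n| <= ((e / 3)%:C : R[i]) /\
    `|(\sum_(a <- tuples_below (size l).+2 N) f a) - gen_deg l' z n N|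
      <= ((e / 3)%:C : R[i]).
  near=> n; split; near: n.
    by move/complex_cvgP: genL; exact.
  by move/complex_cvgP: (fcvg N); exact.
have -> : L - \sum_(a <- tuples_below (size l).+2 N) f a =
   (L - gen_trunc l' z n) + (gen_trunc l' z n - gen_deg l' z n N)
   - (\sum_(a <- tuples_below (size l).+2 N) f a - gen_deg l' z n N).
  by rewrite opprB !(addrA, subrK).
apply: le_trans (ler_normB _ _) _.
apply: le_trans (lerD (ler_normD _ _) (lexx _)) _.
have -> : e = e / 3 + e / 3 + e / 3 by field.
rewrite !rmorphD !lerD//; apply: le_trans (majo _ _) _.
by rewrite lecR.
Unshelve. all: by end_near. Qed.

Lemma nth_weights (F T : Type) (phi : nat -> T -> nat -> nat -> F) w0 t0
    (l : seq (nat * T)) i : (i < size l)%N ->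
  nth w0 (weights phi l) i =
  phi (delta (nth 0 (unzip1 l) i) + delta (nth 0 (unzip1 l) i.+1))%N
    (nth t0 (unzip2 l) i).
Proof.
elim: l i => [|[c t] l IH] [|i] //= il.
exact: IH.
Qed.

Lemma monomial_nth (F : comPzSemiRingType) (zs : seq F) (a : seq nat) :
  size a = size zs ->
  monomial zs a = \prod_(j < size zs) nth 0 zs j ^+ (2 * nth 0%N a j).
Proof.
rewrite /monomial; elim: zs a => [|y zs IH] [|k a] //=.
  by rewrite big_nil big_ord0.
by move=> [sa]; rewrite big_cons big_ord_recl/= IH.
Qed.

(** A bound m < 1 on the moduli gives r = (1 + m)/2, since m <= r^2. *)
Lemma common_radius (R : realType) (s : seq R[i]) : all (fun z => `|z| < 1) s ->
  exists2 r : R, 0 < r < 1 & all (fun z => `|z| <= (r ^+ 2)%:C) s.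
Proof.
move=> s1.
suff [m /andP[m0 m1] sm] : exists2 m : R, 0 <= m < 1 & all (fun z => `|z| <= m%:C) s.
  exists ((1 + m) / 2); first by apply/andP; split; lra.
  apply: sub_all sm => z /le_trans; apply; rewrite lecR.
  by rewrite -subr_ge0; have := sqr_ge0 (1 - m); lra.
elim: s s1 => [|z s IH] /=; first by exists 0; rewrite ?lexx ?ltr01.
move=> /andP[z1 /IH[m /andP[m0 m1] sm]].
have [x zx] : exists x : R, `|z| = x%:C.
  by exists (complex.Re `|z|); rewrite RRe_real// normr_real.
exists (Num.max x m).
  rewrite le_max m0 orbT /= gt_max m1 andbT.
  by rewrite zx -[1]/(1%:C) ltcR in z1.
rewrite zx lecR le_max lexx/=; apply: sub_all sm => w /le_trans; apply.
by rewrite lecR le_max lexx orbT.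
Qed.

Theorem corollary1p4p1 (R : realType) (d : nat) (d_ge1 : (1 <= d)%N)
    (c : d.-tuple nat) (c13 : forall i : 'I_d, tnth c i \in [:: 1%N; 3%N])
    (c1_ge3 : (3 <= nth 0%N c 0)%N)
    (z : 'I_d.+1 -> R[i]) (z_lt1 : forall j : 'I_d.+1, `|z j| < 1) :
  [/\ cvg (partial_sum (zeta_star_term c z) @ totally),
      cvg (partial_sum (chain_term c z) @ totally) &
      sum (zeta_star_term c z) = - sum (chain_term c z)].
Proof.
case: d d_ge1 c c13 c1_ge3 z z_lt1 => // d _ c c13 c1_ge3 z z_lt1.
have c_all : all (mem [:: 1; 3]%N) c.
  by apply/allP => x /tnthP[i ->]; exact: c13.
pose zs := [seq z j | j <- enum 'I_d.+2].
have zsE j : nth 0 zs (j : 'I_d.+2) = z j.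
  by rewrite (nth_map ord0) ?size_enum_ord// nth_ord_enum.
have szzs : size zs = d.+2 by rewrite size_map size_enum_ord.
have [r r01 zr] : exists2 r : R, 0 < r < 1 & all (fun w => `|w| <= (r ^+ 2)%:C) zs.
  apply: common_radius; apply/allP => _ /mapP[j _ ->]; exact: z_lt1.
have [c' cE] : exists c', c = 3%N :: c' :> seq nat.
  case: (val c) (size_tuple c) c_all c1_ge3 => [|c0 c'] //= _ /andP[+ _].
  by rewrite !inE => /orP[] /eqP -> // _; exists c'.
have [z0 [y [zt zsE']]] : exists z0 y zt, zs = [:: z0, y & zt].
  by case: zs szzs {zsE zr} => [|z0 [|y zt]] // _; exists z0, y, zt.
have sc' : size c' = d by have := size_tuple c; rewrite cE => -[].
have szt : size zt = d by move: szzs; rewrite zsE' => -[].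
pose l := zip c' zt.
have sl : size l = d by rewrite size_zip sc' szt minnn.
have u1 : unzip1 l = c' by rewrite unzip1_zip// sc' szt.
have u2 : unzip2 l = zt by rewrite unzip2_zip// sc' szt.
have l13 : all (mem [:: 1; 3]%N) (unzip1 l).
  by move: c_all; rewrite cE u1 => /andP[].
have lr : all (fun w => `|w| <= (r ^+ 2)%:C) (z0 :: unzip2 ((3%N, y) :: l)).
  by rewrite [unzip2 _]/= u2 -zsE'.
have r201 : 0 <= r ^+ 2 < 1.
  by move/andP: r01 => [r0 r1]; rewrite exprn_ge0 ?exprn_ilt1 ?ltW.
have [L [chainL genL]] := @chain_sum_cvg R d (r ^+ 2) z0 y l sl r201 l13 lr.
have zetaL := @zeta_sum_cvg R d r z0 y l (- L) sl r01 l13 lr genL.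
pose ll := [:: (1%N, z0), (3%N, y) & l].
have sll : size ll = d.+2 by rewrite /= sl.
have uz1 : unzip1 ll = 1%N :: c by rewrite /= u1 cE.
have uz2 : unzip2 ll = zs by rewrite /= u2 zsE'.
have [cc sumc] : cvg (partial_sum (chain_term c z) @ totally) /\
    sum (chain_term c z) = L.
  apply: sum_cvgE; congr (_ @ totally --> L): chainL; congr partial_sum.
  apply/funext => k; rewrite -/ll chain_prod_nth ?size_tuple size_weights sll//.
  apply: eq_bigr => i _.
  rewrite (nth_weights _ _ 0) ?sll// uz1 uz2 zsE !(tnth_nth 0%N).
  by rewrite /weight /delta_sum -!rcons_cons !nth_rcons_default.
have [cz sumz] : cvg (partial_sum (zeta_star_term c z) @ totally) /\
    sum (zeta_star_term c z) = - L.
  apply: sum_cvgE; congr (_ @ totally --> - L): zetaL; congr partial_sum.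
  apply/funext => a; rewrite /zeta_star_term -u1 in cE *; rewrite cE; congr (_ * _).
  rewrite u2 -zsE' monomial_nth ?szzs ?size_tuple//.
  by apply: eq_bigr => j _; rewrite zsE (tnth_nth 0%N).
by split; rewrite // sumz sumc.
Qed.
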